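(* Let $\varepsilon >0$, let $\phi_s \in \Phi_\varepsilon$ for all $s >0$, and let $k \in \mathbb{N}$ with $k \geq 2$. (a) If $\mathbb{E}\, H_k(G(\mathcal{P}_s,\phi_s)) \to \alpha \in (0,\infty)$ as $s\to\infty$, then $H_k(G(\mathcal{P}_s,\phi_s)) \stackrel{\mathcal{D}}{\longrightarrow} Z_\alpha$ as $s\to\infty$. (b) If $\mathbb{E}\, H_k(G(\mathcal{P}_s,\phi_s)) \to \infty$ but $\mathbb{E}\, H_k(G(\mathcal{P}_s,\phi_s)) = o(s)$ as $s\to\infty$, then setting $\alpha_s := \mathbb{E}\, H_k(G(\mathcal{P}_s,\phi_s))$, we have $(H_k(G(\mathcal{P}_s,\phi_s)) - \alpha_s)/\sqrt{\alpha_s } \stackrel{\mathcal{D}}{\longrightarrow} \mathcal{N}$ as $s\to\infty$.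
   Context: $(\mathbb{X},\mathcal{F},\mu)$ is an arbitrary probability space. $\Phi$ is the class of all measurable symmetric functions $\phi:\mathbb{X}\times\mathbb{X}\to[0,1]$ (connection functions). For $\varepsilon>0$, $\Phi_\varepsilon$ is the class of all $\phi\in\Phi$ with $$\inf_{x\in\mathbb{X}} \int_{\mathbb{X}}\phi(x,y)\,\mu(dy) \ \geq\ \varepsilon \sup_{x\in\mathbb{X}}\int_{\mathbb{X}}\phi(x,y)\,\mu(dy).$$ Let $X_1,X_2,\ldots$ be independent random elements of $\mathbb{X}$ with common distribution $\mu$. For real $s>0$, $\mathcal{P}_s$ is the Poisson point process $\{X_1,\ldots,X_{N}\}$, where $N$ is Poisson with mean $s$, independent of $(X_i)$; it has mean measure $s\mu$. (Points are counted with multiplicity, i.e. vertices are distinguished by their index $i$.) For $\phi\in\Phi$, $G(\mathcal{P}_s,\phi)$ is the random undirected graph with vertex set $\mathcal{P}_s$ in which, conditionally on $\mathcal{P}_s$, each pair $\{x,y\}$ of points of $\mathcal{P}_s$ is joined by an edge with probability $\phi(x,y)$, independently of all other pairs. For a graph $G$ and $k\geq 2$, $H_k(G)$ is the number of connected induced subgraphs of $G$ of order $k$ (i.e. the number of $k$-element subsets of the vertex set inducing a connected subgraph); in particular $H_2(G)$ is the number of edges. $Z_\alpha$ is a Poisson random variable with parameter $\alpha$; $\mathcal{N}$ is a standard normal random variable; $\stackrel{\mathcal{D}}{\longrightarrow}$ denotes convergence in distribution. $u(s)=o(v(s))$ means $\lim_{s\to\infty}u(s)/v(s)=0$. *)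

(* Defs.v *)
From HB Require Import structures.
From mathcomp Require Import all_boot all_order all_algebra finmap.
From mathcomp Require Import all_classical all_reals all_analysis.

Set Implicit Arguments.
Unset Strict Implicit.
Unset Printing Implicit Defensive.

Import Order.TTheory GRing.Theory Num.Theory.
Import numFieldNormedType.Exports.

Local Open Scope classical_set_scope.
Local Open Scope ring_scope.

Section graphs.
Context {V : finType}.
Implicit Types (e : rel V) (A : {set V}).

Definition induced_rel e A : rel V :=
  fun u v => [&& u \in A, v \in A & e u v].

(* The empty set passes this test, so [conn_subgraphs] below is the paper's
   count only for k >= 1. *)
Definition induced_connected e A : bool :=
  [forall u in A, forall v in A, connect (induced_rel e A) u v].

Definition conn_subgraphs (k : nat) e : nat :=
  #|[set A : {set V} | (#|A| == k) && induced_connected e A]|.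

End graphs.

Section connection_functions.
Context {d} {T : measurableType d} {R : realType} (mu : probability T R).

Record connection_function (phi : T * T -> R) : Prop := ConnectionFunction {
  cf_measurable : measurable_fun [set: T * T] phi ;
  cf_sym : forall x y, phi (x, y) = phi (y, x) ;
  cf_01 : forall p, 0 <= phi p <= 1 }.

Definition mean_connection (phi : T * T -> R) (x : T) : \bar R :=
  (\int[mu]_y (phi (x, y))%:E)%E.

Definition Phi_ (eps : R) (phi : T * T -> R) : Prop :=
  connection_function phi /\
  (eps%:E * ereal_sup (range (mean_connection phi))
     <= ereal_inf (range (mean_connection phi)))%E.

End connection_functions.

Section independence.
Context {d} {Omega : measurableType d} {R : realType} (P : probability Omega R).

Definition mutually_independent (I : choiceType)
    (F : I -> set_system Omega) : Prop :=
  forall (J : {fset I}) (A : I -> set Omega),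
    (forall i, i \in J -> F i (A i)) ->
    P (\bigcap_(i in [set` J]) A i) = (\prod_(i <- J) P (A i))%E.

Definition sigma_of {d'} {U : measurableType d'} (Y : Omega -> U) :
  set_system Omega := preimage_set_system setT Y measurable.

End independence.

Section random_connection_model.
Context {d} {T : measurableType d} {R : realType} (mu : probability T R).
Context {dO} {Omega : measurableType dO} (P : probability Omega R).
Variables (s : R) (phi : T * T -> R).
Variables (N : {RV P >-> nat}) (X : nat -> {RV P >-> T}).
Variable E : nat -> nat -> {RV P >-> bool}.

(* [rcm_cond] is the defining property of a conditional probability: given
   that N = n and given the positions X 0, ..., X (n - 1), the indicators of
   the edges ij (i < j < n) are independent Bernoulli variables with parameters
   phi (X i, X j).  Edges between indices that are not both smaller than N are
   unconstrained; they are not part of the graph.  The second argument of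
   [poisson_prob] is a dummy. *)
Record random_connection_model : Prop := RandomConnectionModel {
  rcm_N : forall A, distribution P N A = poisson_prob s 0 A ;
  rcm_X : forall i B, measurable B -> distribution P (X i) B = mu B ;
  rcm_indep : mutually_independent P
    (fun o : option nat => if o is Some i then sigma_of (X i) else sigma_of N) ;
  rcm_sym : forall i j w, E i j w = E j i w ;
  rcm_irr : forall i w, E i i w = false ;
  rcm_cond : forall (n : nat) (B : set (n.-tuple T)) (g : rel 'I_n),
    measurable B ->
    let A := [set w | N w = n /\ B [tuple X i w | i < n]] in
    P (A `&` [set w | forall i j : 'I_n, (i < j)%N -> E i j w = g i j]) =
    (\int[P]_(w in A)
       (\prod_(i < n) \prod_(j < n | (i < j)%N)
          (if g i j then phi (X i w, X j w) else 1 - phi (X i w, X j w)))%:E)%E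
  }.

(* Vertices are the indices of the points, so points are counted with
   multiplicity. *)
Definition rcm_H (k : nat) (w : Omega) : nat :=
  conn_subgraphs k (fun i j : 'I_(N w) => E i j w).

End random_connection_model.

Section convergence_in_distribution.
Context {R : realType}.

(* The random variables Y s may live on different probability spaces; their
   limit is given by its law. *)
Definition cvg_in_distribution {d} {Omega : R -> measurableType d}
    (P : forall s, probability (Omega s) R) (Y : forall s, Omega s -> R)
    (nu : probability (measurableTypeR R) R) : Prop :=
  forall t : R, {for t, continuous (fun r : R => nu `]-oo, r]%classic)} ->
    P s [set w | Y s w <= t] @[s --> +oo] --> nu `]-oo, t]%classic.

Definition natr (n : nat) : measurableTypeR R := n%:R.

Lemma measurable_natr : measurable_fun [set: nat] natr.
Proof. by []. Qed.

HB.instance Definition _ := isMeasurableFun.Build _ _ _ _ natr measurable_natr.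

(* law on the real line of a Poisson variable with parameter alpha *)
Definition poisson_law (alpha : R) : probability (measurableTypeR R) R :=
  distribution (poisson_prob alpha 0) natr.

End convergence_in_distribution.

(* Main.v *)
Require Import Defs.
From HB Require Import structures.
From mathcomp Require Import all_boot all_order all_algebra finmap.
From mathcomp Require Import all_classical all_reals all_analysis.
From mathcomp Require Import measurable_realfun ring lra.

Set Implicit Arguments.
Unset Strict Implicit.
Unset Printing Implicit Defensive.

Import Order.TTheory GRing.Theory Num.Theory.
Import numFieldNormedType.Exports.

Local Open Scope classical_set_scope.
Local Open Scope ring_scope.

(* Stein's method.  Write H for the number of connected induced subgraphs of
   order k, alpha for its mean, and p_m for the probability that m independent
   points span a connected graph, so that alpha = s^k p_k / k!.  The Palm
   identity for the Poisson process gives, for every f >= 0,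
     E (sum over k-sets A of 1(A connected) f(H_A + 1)) = alpha E f(H + 1),
   where H_A counts the k-sets disjoint from A.  Since H = H_A + 1 + (number of
   connected B <> A meeting A) when A is connected, any L-Lipschitz f satisfies
     |alpha E f(H + 1) - E (H f(H))| <= L sum_(k < m <= 2k) 4^m s^m p_m / m!,
   as the union of two overlapping connected sets is connected and has at most
   4^m decompositions.  Let x be the maximal expected degree.  Adding or
   removing one vertex of a connected graph shows
   p_(m+1) <= m (m+1) p_m x / s, whereas p_m >= (eps x / s)^(m-1) because phi is
   in Phi_eps.  Hence alpha = o(s) forces x -> 0, and the right-hand side is
   L alpha O(x).

   For (a), point indicators f yield (j+1) P(H = j+1) - alpha P(H = j) -> 0, so
   the point probabilities converge to the Poisson ones; Markov's inequality
   gives tightness.  For (b), f is a solution of the Stein equation of the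
   normal law on the lattice (j - alpha) / sqrt alpha, written with the function
   U(x) = int_0^oo exp(x r - r^2 / 2) dr; its Lipschitz constant is
   O(1 / sqrt alpha). *)

(** Expectations are expanded into a Poisson series in the number n of points, whose n-th term is an
    integral over n independent positions of a finite sum over edge configurations. Independence of
    disjoint vertex sets is proved for edges and for positions separately; the Palm identity then
    follows from a binomial identity for Poisson weights. U is the normal distribution function
    divided by its density. It satisfies U' = 1 + x U, and both U and U' are nonnegative and
    increasing, so that bounds on increments replace differentiation under the integral. The Stein
    solution is a multiple of U on the left of the threshold and of its reflection on the right. The
    threshold is moved to a lattice point, where the two pieces agree, so that no difference
    quotient straddles the kink. With h = 1 / sqrt alpha, a Lipschitz constant O(h) turns h L alpha
    O(x) into h^2 alpha O(x) = O(x): the mean cancels. The hypothesis k >= 2 enters where alpha >= s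
    (eps x)^(k-1) / k! has to force x -> 0. *)

Section bernoulli_sums.
Context {R : comNzRingType}.

(** Expectation of [F] under independent coins, [b i] being the weights of the two faces of coin
    [i]; given the positions, the edges are such coins. *)
Definition bern (I : finType) (b : I -> bool -> R)
    (F : {ffun I -> bool} -> R) : R :=
  \sum_(g : {ffun I -> bool}) (\prod_i b i (g i)) * F g.

Definition reindex_ffun (I J : finType) (c : J -> I) (g : {ffun I -> bool}) :
  {ffun J -> bool} := [ffun j => g (c j)].

(** Independence of functions of disjoint coordinates: the weight of all configurations with
    prescribed restrictions factorises, and each coin that neither map reads sums to 1. *)
Lemma bern_reindex2 (I J K : finType) (b : I -> bool -> R) (c : J -> I)
    (c' : K -> I) (F : {ffun J -> bool} -> R) (F' : {ffun K -> bool} -> R) :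
  (forall i, b i true + b i false = 1) -> injective c -> injective c' ->
  (forall j k, c j != c' k) ->
  bern b (fun g => F (reindex_ffun c g) * F' (reindex_ffun c' g)) =
  bern (b \o c) F * bern (b \o c') F'.
Proof.
move=> b1 c_inj c'_inj cc'.
(* [Q h h' i] holds the values that the restrictions [h] and [h'] allow at [i]. The configurations
   with these restrictions thus form a product set, over which a sum of products is a product of
   sums. *)
pose Q h h' i := [pred y | [forall j, (c j == i) ==> (y == h j)] &&
  [forall j, (c' j == i) ==> (y == h' j)]] : pred bool.
have QP (h : {ffun J -> bool}) (h' : {ffun K -> bool}) g :
    (g \in family (Q h h')) = (reindex_ffun c g == h) && (reindex_ffun c' g == h').
  apply/familyP/andP => [gQ|[/eqP <- /eqP <-] i]; last first.
    by rewrite inE; apply/andP; split; apply/forallP => j;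
      apply/implyP => /eqP <-; rewrite ffunE.
  split; apply/eqP/ffunP => j; rewrite ffunE.
    have := gQ (c j); rewrite inE => /andP[/forallP/(_ j)].
    by rewrite eqxx => /eqP.
  have := gQ (c' j); rewrite inE => /andP[_ /forallP/(_ j)].
  by rewrite eqxx => /eqP.
have prodQ h h' : \prod_i \sum_(y | Q h h' i y) b i y =
    (\prod_j b (c j) (h j)) * \prod_j b (c' j) (h' j).
  rewrite (bigID (mem (codom c))) /= (bigID (mem (codom c')) (fun i => i \notin codom c)) /=.
  rewrite [X in _ * (_ * X)]big1 ?mulr1; last first.
    move=> i /andP[ic ic']; rewrite (eq_bigl xpredT) ?big_bool //= => y.
    apply/andP; split; apply/forallP => j; apply/implyP => /eqP ji.
      by rewrite -ji codom_f in ic.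
    by rewrite -ji codom_f in ic'.
  congr (_ * _).
    transitivity (\prod_(i <- codom c) \sum_(y | Q h h' i y) b i y).
    by rewrite (big_uniq (codom c)) //; apply/injectiveP.
    rewrite /image_mem big_map big_enum/=.
    apply: eq_bigr => j _; rewrite (big_pred1 (h j)) // => y /=.
    apply/andP/eqP => [[/forallP/(_ j)]|->].
      by rewrite eqxx => /eqP.
    split; apply/forallP => j'; apply/implyP => /eqP.
      by move/c_inj => ->.
    by move=> e; have := cc' j j'; rewrite e eqxx.
  rewrite (eq_bigl (mem (codom c'))); last first.
    move=> i; rewrite andb_idl // => /codomP[k ->].
    by apply/codomP => -[j e]; have := cc' j k; rewrite e eqxx.
  transitivity (\prod_(i <- codom c') \sum_(y | Q h h' i y) b i y).
    by rewrite (big_uniq (codom c')) //; apply/injectiveP.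
  rewrite /image_mem big_map big_enum/=.
  apply: eq_bigr => j _; rewrite (big_pred1 (h' j)) // => y /=.
  apply/andP/eqP => [[_ /forallP/(_ j)]|->].
    by rewrite eqxx => /eqP.
  split; apply/forallP => j'; apply/implyP => /eqP.
    by move=> e; have := cc' j' j; rewrite e eqxx.
  by move/c'_inj => ->.
transitivity (\sum_h \sum_h' F h * F' h' * \sum_(g in family (Q h h')) \prod_i b i (g i)).
  rewrite /bern; under [RHS]eq_bigr => h _ do under eq_bigr => h' _ do
    rewrite mulr_sumr (eq_bigl _ _ (QP h h')) big_mkcond /=.
  under [RHS]eq_bigr do rewrite exchange_big /=.
  rewrite exchange_big /=; apply: eq_bigr => g _.
  rewrite (bigD1 (reindex_ffun c g)) //= (bigD1 (reindex_ffun c' g)) //= !eqxx /=.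
  rewrite [X in _ = _ + X + _]big1 ?addr0; last first.
    by move=> h hn; rewrite [_ == h]eq_sym (negbTE hn).
  rewrite [X in _ = _ + X]big1 ?addr0 1?mulrC // => h hn.
  by apply: big1 => h' _; rewrite [_ == h]eq_sym (negbTE hn).
rewrite /bern mulr_suml; apply: eq_bigr => h _; rewrite mulr_sumr.
apply: eq_bigr => h' _; rewrite -bigA_distr_big_dep prodQ.
by rewrite [RHS]mulrACA mulrC.
Qed.

Lemma bern1 (I : finType) (b : I -> bool -> R) :
  (forall i, b i true + b i false = 1) -> bern b (fun=> 1) = 1.
Proof.
move=> b1; rewrite /bern; under eq_bigr do rewrite mulr1.
by rewrite -bigA_distr_bigA big1 // => i _; rewrite big_bool /= b1.
Qed.

Lemma bern_sum (I K : finType) (b : I -> bool -> R) (D : pred K)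
    (F : K -> {ffun I -> bool} -> R) :
  bern b (fun g => \sum_(k | D k) F k g) = \sum_(k | D k) bern b (F k).
Proof.
rewrite /bern exchange_big /=.
by under eq_bigr do rewrite mulr_sumr.
Qed.

Lemma bern_at (I : finType) (b : I -> bool -> R) i :
  (forall i, b i true + b i false = 1) -> bern b (fun g => (g i)%:R) = b i true.
Proof.
move=> b1; pose b' j y := b j y * (if j == i then y%:R else 1).
transitivity (\prod_j \sum_y b' j y).
  rewrite bigA_distr_bigA; apply: eq_bigr => g _.
  rewrite /b' big_split /=; congr (_ * _).
  rewrite (bigD1 i) //= eqxx big1 ?mulr1 // => j ji.
  by rewrite (negbTE ji).
rewrite (bigD1 i) //= [X in _ * X]big1 ?mulr1; last first.
  by move=> j ji; rewrite big_bool /b' /= (negbTE ji) !mulr1.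
by rewrite big_bool /b' /= eqxx mulr1 mulr0 addr0.
Qed.

End bernoulli_sums.

Lemma le_bern (R : realType) (I : finType) (b : I -> bool -> R)
    (F F' : {ffun I -> bool} -> R) :
  (forall i y, 0 <= b i y) -> (forall g, F g <= F' g) -> bern b F <= bern b F'.
Proof.
move=> b0 FF'; apply: ler_sum => g _; apply: ler_wpM2l => //.
exact: prodr_ge0.
Qed.

Lemma bern_ge0 (R : realType) (I : finType) (b : I -> bool -> R)
    (F : {ffun I -> bool} -> R) :
  (forall i y, 0 <= b i y) -> (forall g, 0 <= F g) -> 0 <= bern b F.
Proof. by move=> b0 F0; apply: sumr_ge0 => g _; rewrite mulr_ge0 // prodr_ge0. Qed.

(** * Connected vertex sets of a finite graph *)

Section induced_connectivity.
Local Open Scope set_scope.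
Context {V : finType} (e : rel V).
Implicit Types A B : {set V}.

Lemma induced_connectedP A : reflect
  (forall u v, u \in A -> v \in A -> connect (induced_rel e A) u v)
  (induced_connected e A).
Proof.
apply: (iffP forall_inP) => [H u v uA vA|H u uA].
  exact: (forall_inP (H u uA)).
by apply/forall_inP => v vA; exact: H.
Qed.

Lemma connect_induced_sub A B u v : A \subset B ->
  connect (induced_rel e A) u v -> connect (induced_rel e B) u v.
Proof.
move=> /fintype.subsetP AB; apply: connect_sub => x y /and3P[xA yA exy].
by apply: connect1; rewrite /induced_rel !AB.
Qed.

Lemma induced_connected1 v : induced_connected e [set v].
Proof.
by apply/induced_connectedP => x y; rewrite !inE => /eqP -> /eqP ->.
Qed.

Lemma induced_connectedU A B : induced_connected e A -> induced_connected e B ->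
  A :&: B != finset.set0 -> induced_connected e (A :|: B).
Proof.
move=> /induced_connectedP cA /induced_connectedP cB /set0Pn[w].
rewrite inE => /andP[wA wB].
have cUA u v : u \in A -> v \in A -> connect (induced_rel e (A :|: B)) u v.
  by move=> uA vA; apply: connect_induced_sub (cA _ _ uA vA); exact: finset.subsetUl.
have cUB u v : u \in B -> v \in B -> connect (induced_rel e (A :|: B)) u v.
  by move=> uB vB; apply: connect_induced_sub (cB _ _ uB vB); exact: finset.subsetUr.
apply/induced_connectedP => u v /setUP[uA|uB] /setUP[vA|vB].
- exact: cUA.
- exact: connect_trans (cUA u w uA wA) (cUB w v wB vB).
- exact: connect_trans (cUB u w uB wB) (cUA w v wA vA).
- exact: cUB.
Qed.

(** A path from inside [A] to outside has a first edge that leaves [A]; the induction follows the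
    path while it stays in [A]. *)
Lemma boundary_edge A : induced_connected e finset.setT -> A != finset.set0 -> A != finset.setT ->
  exists u v, [/\ u \in A, v \notin A & e u v].
Proof.
move=> /induced_connectedP cT /set0Pn[x xA] /eqP/finset.setP AT.
have [y yA] : exists y, y \notin A.
  apply/existsP; apply: contra_notT AT => /existsPn H y.
  by have := H y; rewrite negbK inE => ->.
have /connectP[p] := cT x y (finset.in_setT _) (finset.in_setT _).
elim: p x xA => [|z p IH] x xA /=; first by move=> _ yx; rewrite yx xA in yA.
move=> /andP[/and3P[_ _ exz] pz] yz.
have [zA|zA] := boolP (z \in A); first exact: IH zA pz yz.
by exists x, z.
Qed.

Hypothesis esym : symmetric e.

Lemma induced_connected_add A u v : induced_connected e A -> u \in A -> e u v ->
  induced_connected e (v |: A).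
Proof.
move=> cA uA euv; have cuv : induced_connected e [set u; v].
  apply/induced_connectedP => x y; rewrite !inE.
  move=> /orP[] /eqP -> /orP[] /eqP -> //; apply: connect1;
  by rewrite /induced_rel !inE !eqxx ?orbT //= esym.
rewrite (_ : v |: A = A :|: [set u; v]); last first.
  by apply/finset.setP => x; rewrite !inE; case: eqVneq => [->|_]; case: eqVneq => [->|_];
    rewrite ?uA ?orbT ?orbF.
by apply: induced_connectedU => //; apply/set0Pn; exists u; rewrite !inE uA eqxx.
Qed.

(** A singleton is enlarged one vertex at a time along boundary edges. *)
Lemma connected_subset_card j : induced_connected e finset.setT -> (0 < j <= #|V|)%N ->
  exists A, #|A| = j /\ induced_connected e A.
Proof.
move=> cT; case: j => // j /=; elim: j => [|j IH] jV.
  have /card_gt0P[v _] := jV.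
  by exists [set v]; rewrite cards1; split=> //; exact: induced_connected1.
have [A [cardA cA]] := IH (ltnW jV).
have A0 : A != finset.set0 by rewrite -card_gt0 cardA.
have AT : A != finset.setT.
  by apply: contraTneq jV => AT; rewrite -cardsT -AT cardA -leqNgt.
have [u [v [uA vA euv]]] := boundary_edge cT A0 AT.
exists (v |: A); rewrite cardsU1 vA cardA; split=> //.
exact: induced_connected_add uA euv.
Qed.

(** Growth stopped one vertex short of the whole graph leaves out a single [v], and a boundary edge
    gives it a neighbour [u]. This is the deletion step behind the upper bound on connection
    probabilities. *)
Lemma connected_removable : (1 < #|V|)%N -> induced_connected e finset.setT ->
  exists u v, [/\ u != v, e u v & induced_connected e [set~ v]].
Proof.
move=> V1 cT.
have [A [cardA cA]] : exists A, #|A| = #|V|.-1 /\ induced_connected e A.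
  by apply: connected_subset_card => //; rewrite leq_pred -subn1 subn_gt0 V1.
have A0 : A != finset.set0 by rewrite -card_gt0 cardA -subn1 subn_gt0.
have AT : A != finset.setT.
  apply: contraTneq V1 => AT; move: cardA; rewrite AT cardsT.
  by case: #|V| => [|n] //= /eqP; rewrite (gtn_eqF (ltnSn n)).
have [u [v [uA vA euv]]] := boundary_edge cT A0 AT.
have Av : A = [set~ v].
  apply/eqP; rewrite eqEcard cardsC1 cardA leqnn andbT.
  by apply/fintype.subsetP => x xA; rewrite !inE; apply: contraNneq vA => <-.
exists u, v; rewrite -Av; split=> //.
by apply: contraNneq vA => <-.
Qed.

End induced_connectivity.

(* In [Defs] the set comprehension is a classical set. *)
Lemma conn_subgraphs_card (V : finType) (e : rel V) k : conn_subgraphs k e =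
  #|[set A : {set V} | (#|A| == k) && induced_connected e A]%SET|.
Proof. by apply: eq_card => A; rewrite inE; apply/idP/idP; rewrite in_setE. Qed.

Section relabelling.
Local Open Scope set_scope.
Context {V V' : finType} (e : rel V) (c : V' -> V).
Hypothesis c_inj : injective c.
Let e' : rel V' := fun u v => e (c u) (c v).

Lemma induced_connected_relabel (B : {set V'}) :
  induced_connected e' B = induced_connected e (c @: B).
Proof.
have mem_c u : (c u \in c @: B) = (u \in B) by rewrite mem_imset.
apply/induced_connectedP/induced_connectedP => H u v.
  move=> /imsetP[x xB ->] /imsetP[y yB ->].
  have /connectP[p pp ->] := H x y xB yB.
  elim: p x {xB} pp => [|z p IH] x //= /andP[/and3P[xB zB exz] /IH].
  by apply: connect_trans; apply: connect1; rewrite /induced_rel !mem_c xB zB.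
move=> uB vB; have /connectP[p] := H (c u) (c v) (imset_f _ uB) (imset_f _ vB).
elim: p u {uB} => [|z p IH] u /=; first by move=> _ /c_inj ->.
move=> /andP[/and3P[uB /imsetP[x xB ->] eux] px] vx.
apply: connect_trans (IH _ px vx); apply: connect1.
by rewrite /induced_rel xB -mem_c uB.
Qed.

Lemma conn_subgraphs_relabel k : conn_subgraphs k e' =
  #|[set A : {set V} | [&& #|A| == k, A \subset c @: finset.setT & induced_connected e A]]|.
Proof.
rewrite conn_subgraphs_card -(card_imset _ (imset_inj c_inj)); apply: eq_card => A.
rewrite inE; apply/imsetP/and3P => [[B]|[cA sA iA]].
  rewrite inE induced_connected_relabel => /andP[/eqP <- iB ->].
  by rewrite card_imset // eqxx finset.imsetS // finset.subsetT.
have Ac : A = c @: (c @^-1: A).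
  apply/finset.setP => x; apply/idP/imsetP => [xA|[y]]; last by rewrite inE => yA ->.
  have /imsetP[y _ xy] := fintype.subsetP sA x xA.
  by exists y => //; rewrite inE -xy.
exists (c @^-1: A) => //.
by rewrite inE induced_connected_relabel -Ac iA andbT -(card_imset _ c_inj) -Ac.
Qed.

End relabelling.

Section counting.
Local Open Scope set_scope.
Context {V : finType} (e : rel V) (k : nat).
Local Open Scope nat_scope.
Local Notation conn A := ((#|A| == k) && induced_connected e A).

Lemma conn_subgraphsE :
  conn_subgraphs k e = \sum_(A : {set V} | #|A| == k) induced_connected e A.
Proof.
rewrite conn_subgraphs_card -sum1_card [RHS]big_mkcond [LHS]big_mkcond /=.
apply: eq_bigr => A _; rewrite inE.
by case: (#|A| == k) => //=; case: induced_connected.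
Qed.

(** Ordered pairs, listed by their first member, because the Stein estimate charges to each
    connected [A] the sets that overlap it. *)
Definition overlapping_pairs : nat := \sum_(A : {set V} | conn A)
  #|[set B : {set V} | [&& conn B, B != A & A :&: B != finset.set0]]|.

Lemma overlapping_pairs_le : overlapping_pairs <=
  \sum_(k.+1 <= m < (2 * k).+1) 4 ^ m * conn_subgraphs m e.
Proof.
pose Q (A B : {set V}) := [&& conn A, conn B, B != A & A :&: B != finset.set0].
have -> : overlapping_pairs = \sum_(p : {set V} * {set V}) Q p.1 p.2.
  rewrite -(pair_bigA _ (fun A B => nat_of_bool (Q A B))) /=.
  rewrite /overlapping_pairs big_mkcond /=; apply: eq_bigr => A _.
  rewrite /Q; case: ifP => cA; last by rewrite big1.
  rewrite -sum1_card big_mkcond /=; apply: eq_bigr => B _; rewrite inE.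
  by case: ifP.
pose S m := [set A : {set V} | (#|A| == m) && induced_connected e A].
have QS A B : Q A B -> exists2 m, k < m < (2 * k).+1 & A :|: B \in S m.
  case/and4P => /andP[/eqP cA iA] /andP[/eqP cB iB] BA AB.
  exists #|A :|: B|; last by rewrite inE eqxx induced_connectedU.
  rewrite ltnS cardsU mul2n -addnn cA cB leq_subr andbT.
  (* Since [B] has the size of [A] and differs from it, [B] is not contained in [A], and the union
     has at least k + 1 vertices. This extra vertex is what yields the small factor x. *)
  have : A \proper A :|: B.
    rewrite properE finset.subsetUl finset.subUset fintype.subxx /=.
    apply: contra BA => BA; apply/eqP/eqP; rewrite eqEcard BA.
    by rewrite cA cB leqnn.
  by move=> /proper_card; rewrite cA cardsU cA cB.
apply: (@leq_trans (\sum_(p : {set V} * {set V})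
    \sum_(k.+1 <= m < (2 * k).+1) (p.1 :|: p.2 \in S m))).
  apply: leq_sum => -[A B] _ /=; case Qp: (Q A B) => //=.
  have [m km mS] := QS _ _ Qp.
  rewrite (bigD1_seq m) /= ?mem_index_iota ?iota_uniq //=.
  by rewrite mS.
rewrite exchange_big /=; apply: leq_sum => m _.
rewrite conn_subgraphs_card -/(S m) mulnC -sum_nat_const.
rewrite (eq_bigr (fun p => \sum_(C in S m) (p.1 :|: p.2 == C))); last first.
  move=> p _; case: (boolP (_ \in S m)) => pS.
    rewrite (bigD1 (p.1 :|: p.2)) //= eqxx big1 // => C /andP[_].
    by rewrite eq_sym => /negbTE ->.
  by rewrite big1 // => C CS; case: eqP => // pC; rewrite pC CS in pS.
rewrite exchange_big /=; apply: leq_sum => C; rewrite inE => /andP[/eqP Cm _].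
apply: (@leq_trans #|finset.setX (powerset C) (powerset C)|); last first.
  by rewrite cardsX card_powerset Cm -expnMn.
rewrite -sum1_card [X in _ <= X]big_mkcond /=; apply: leq_sum => -[A B] _ /=.
by case: eqP => //= <-; rewrite !inE finset.subsetUl finset.subsetUr.
Qed.

End counting.

(** * Stein's estimate on one fixed graph *)

Section stein_pointwise.
Context {V : finType} (e : rel V) (k : nat) (R : realType).
Hypothesis k_gt0 : (0 < k)%N.
Local Open Scope set_scope.
Local Notation conn A := ((#|A| == k) && induced_connected e A).

(** The H_A of the overview. It reads only the graph on the complement of [A], which makes it
    independent of the connectedness of [A] once the graph is random. *)
Definition count_avoiding (A : {set V}) : nat :=
  #|[set B : {set V} | [&& #|B| == k, B \subset ~: A & induced_connected e B]]|.

Lemma conn_subgraphs_split (A : {set V}) : conn A ->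
  conn_subgraphs k e = (count_avoiding A + 1 +
    #|[set B : {set V} | [&& conn B, B != A & A :&: B != finset.set0]]|)%N.
Proof.
move=> cA; rewrite conn_subgraphs_card -(cardsID [set B : {set V} | B \subset ~: A]).
rewrite -addnA; congr (_ + _)%N.
  apply: eq_card => B; rewrite !inE; case: (#|B| == k) => //=.
  by rewrite andbC.
have disjE (B : {set V}) : (B \subset ~: A) = (A :&: B == finset.set0).
  by rewrite -finset.disjoints_subset -finset.setI_eq0 finset.setIC.
rewrite (cardsD1 A) !inE cA disjE finset.setIid -cards_eq0.
(* Since k > 0, [A] meets itself; so it is not among the sets avoiding [A] and accounts for the term
   1. *)
have -> /= : #|A| != 0%N by case/andP: cA => /eqP ->; rewrite -lt0n.
congr (1 + _)%N; apply: eq_card => B; rewrite !inE disjE.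
by do !case: (_ == _); do ?case: induced_connected.
Qed.

Lemma lipschitz_nat (f : nat -> R) (L : R) i j :
  (forall i, `|f i.+1 - f i| <= L) -> `|f (i + j)%N - f i| <= L * j%:R.
Proof.
move=> fL; elim: j => [|j IH]; first by rewrite addn0 subrr normr0 mulr0.
rewrite addnS (_ : _ - _ = (f (i + j).+1 - f (i + j)%N) + (f (i + j)%N - f i)).
  by rewrite (le_trans (ler_normD _ _)) // -natr1 mulrDr mulr1 addrC lerD.
by rewrite addrA subrK.
Qed.

(** A disconnected [A] contributes to neither sum. For a connected one, H exceeds H_A + 1 by the
    number of sets overlapping [A], and the Lipschitz bound turns this number into a cost. *)
Lemma stein_pointwise (f : nat -> R) (L : R) :
  (forall i, `|f i.+1 - f i| <= L) ->
  `|\sum_(A : {set V} | #|A| == k) (induced_connected e A)%:R *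
      f (count_avoiding A).+1 -
    (conn_subgraphs k e)%:R * f (conn_subgraphs k e)|
  <= L * (overlapping_pairs e k)%:R.
Proof.
move=> fL; rewrite {1}conn_subgraphsE natr_sum mulr_suml -sumrB.
rewrite (le_trans (ler_norm_sum _ _ _)) //.
rewrite /overlapping_pairs natr_sum mulr_sumr.
rewrite [leRHS]big_mkcondr /=; apply: ler_sum => A cA.
case: ifPn => iA; last by rewrite !mul0r subrr normr0.
have cAA : conn A by rewrite cA iA.
rewrite !mul1r distrC (conn_subgraphs_split cAA) addn1.
exact: lipschitz_nat.
Qed.

End stein_pointwise.

(** * Labelled graphs coded by finite functions *)

Section graph_codes.

(* Only the entries (i, j) with i < j carry the graph. *)
Definition graph n := {ffun 'I_n * 'I_n -> bool}.

Definition adj n (g : graph n) : rel 'I_n :=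
  fun i j => (i != j) && g (if (i < j)%N then (i, j) else (j, i)).

Lemma adj_sym n (g : graph n) : symmetric (adj g).
Proof. by move=> i j; rewrite /adj eq_sym; case: ltngtP => // /val_inj ->. Qed.

Definition pull m n (c : 'I_m -> 'I_n) (g : graph n) : graph m :=
  reindex_ffun (fun p => (c p.1, c p.2)) g.

(** Such maps respect the orientation i < j of the entries that carry the graph, so pulling back a
    code along them commutes with [adj]. By [increasing_enum] their images reach every vertex
    set. *)
Definition increasing m n (c : 'I_m -> 'I_n) :=
  forall i j, (c i < c j)%N = (i < j)%N.

Lemma increasing_inj m n (c : 'I_m -> 'I_n) : increasing c -> injective c.
Proof.
move=> cI i j cij; apply: val_inj; have := cI i j; have := cI j i.
by rewrite cij ltnn; case: ltngtP.
Qed.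

Lemma adj_pull m n (c : 'I_m -> 'I_n) (g : graph n) : increasing c ->
  adj (pull c g) = (fun i j => adj g (c i) (c j)).
Proof.
move=> cI; apply/funext => i; apply/funext => j.
rewrite /adj /pull ffunE (inj_eq (increasing_inj cI)) cI.
by case: (i < j)%N.
Qed.

Lemma increasing_enum n (A : {set 'I_n}) m : #|A| = m ->
  exists c : 'I_m -> 'I_n, increasing c /\ (c @: finset.setT = A)%SET.
Proof.
move=> cardA; pose c (i : 'I_m) := enum_val (cast_ord (esym cardA) i).
have sA : sorted ltn (map val (enum A)).
  rewrite /enum_mem -enumT sorted_map.
  apply: sorted_filter; first by move=> x y z /= /ltn_trans; apply.
  by rewrite -sorted_map val_enum_ord iota_ltn_sorted.
have cE i : c i = nth 0%N (map val (enum A)) i :> nat.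
  rewrite (nth_map (enum_default (cast_ord (esym cardA) i))) //.
  by rewrite -cardE cardA.
have cH (i j : 'I_m) : (i < j)%N -> (c i < c j)%N.
  move=> ij; rewrite !cE; apply: (sorted_ltn_nth ltn_trans) => //;
  by rewrite inE size_map -cardE cardA.
exists c; split.
  move=> i j; case: (ltngtP i j) => [/cH //|/cH|/val_inj ->]; last by rewrite ltnn.
  by case: ltngtP.
apply/finset.setP => x; apply/imsetP/idP => [[i _ ->]|xA].
  exact: enum_valP.
exists (cast_ord cardA (enum_rank_in xA x)) => //.
by rewrite /c cast_ordK enum_rankK_in.
Qed.

Lemma induced_connected_pull m n (c : 'I_m -> 'I_n) (g : graph n) :
  increasing c -> induced_connected (adj (pull c g)) finset.setT =
  induced_connected (adj g) (c @: finset.setT)%SET.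
Proof.
move=> cI; rewrite adj_pull //.
exact: induced_connected_relabel (increasing_inj cI) _.
Qed.

Lemma count_avoiding_pull m n (c : 'I_m -> 'I_n) (g : graph n) (A : {set 'I_n}) k :
  increasing c -> (c @: finset.setT = ~: A)%SET ->
  count_avoiding (adj g) k A = conn_subgraphs k (adj (pull c g)).
Proof.
move=> cI cA; rewrite adj_pull // conn_subgraphs_relabel ?cA //.
exact: increasing_inj.
Qed.

End graph_codes.

(** * Mean values over independent positions and edges *)

Section tuple_measures.
Context {d : measure_display} {T : measurableType d} {R : realType}.

Definition box n (B : 'I_n -> set T) : set (n.-tuple T) :=
  [set x | forall i, B i (tnth x i)].

Lemma measurable_box n (B : 'I_n -> set T) :
  (forall i, measurable (B i)) -> measurable (box B).
Proof.
move=> mB; rewrite (_ : box B = \bigcap_i ((@tnth n T)^~ i @^-1` B i)); last first.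
  by apply/seteqP; split => [x Bx i _|x Bx i]; [exact: Bx|exact: Bx].
apply: fin_bigcap_measurable => [|i _]; first exact: finite_finset.
by rewrite -[X in measurable X]setTI; exact: measurable_tnth.
Qed.

(** Boxes are stable under intersection and generate the sigma-algebra of tuples; finiteness allows
    the constant sequence [setT] as exhaustion. *)
Lemma tuple_measure_unique n (m1 m2 : {measure set (n.-tuple T) -> \bar R}) :
  (m1 setT < +oo)%E ->
  (forall B : 'I_n -> set T, (forall i, measurable (B i)) ->
    m1 (box B) = m2 (box B)) ->
  forall A, measurable A -> m1 A = m2 A.
Proof.
move=> m1oo m12 A mA.
pose G := [set box B | B in [set B : 'I_n -> set T | forall i, measurable (B i)]].
have boxT : @box n (fun=> setT) = setT by apply/seteqP; split.
apply: (measure_unique G (fun=> setT)) mA => //.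
- apply/seteqP; split; last first.
    apply: smallest_sub; first exact: sigma_algebra_measurable.
    by move=> _ [B mB <-]; exact: measurable_box.
  apply: smallest_sub; first exact: smallest_sigma_algebra.
  move=> C; rewrite -bigcup_seq => -[i _ [B mB <-]]; apply: sub_sigma_algebra.
  exists (fun j => if j == i then B else setT).
    by move=> j /=; case: ifP.
  rewrite setTI; apply/seteqP; split => [x /(_ i)|x Bx j /=]; first by rewrite eqxx.
  by case: eqP => // ->.
- move=> _ _ [B mB <-] [B' mB' <-]; exists (fun i => B i `&` B' i).
    by move=> i; exact: measurableI.
  apply/seteqP; split => [x xB|x [xB xB'] i]; last by split; [exact: xB|exact: xB'].
  by split => i; have [] := xB i.
- by move=> _; exists (fun=> setT).
- by apply/seteqP; split => // x _; exists 0%N.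
- by move=> _ [B mB <-]; exact: m12.
Qed.

End tuple_measures.

Lemma ge0_integral_mrestr (d : measure_display) (T : measurableType d)
    (R : realType) (mu : {measure set T -> \bar R}) (A : set T)
    (mA : measurable A) (f : T -> \bar R) :
  measurable_fun [set: T] f -> (forall x, 0 <= f x)%E ->
  (\int[mrestr mu mA]_x f x = \int[mu]_(x in A) f x)%E.
Proof.
move=> mf f0; rewrite -(setUv A) ge0_integral_setU //=.
- rewrite (eq_measure_integral mu); last first.
    by move=> B mB BA; rewrite /= /mrestr (setIidl BA).
  rewrite [X in (_ + X)%E](_ : _ = 0%E) ?adde0 //.
  apply: null_set_integral; first exact: measurableC.
    exact: measurable_funTS.
  by rewrite /= /mrestr setICl measure0.
- exact: measurableC.
- by rewrite setUv.
- by apply/disj_setPCl.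
Qed.

Section independence_of_positions.
Context {d : measure_display} {T : measurableType d} {R : realType}.
Context (mu : probability T R).
Context {dO : measure_display} {Omega : measurableType dO}.
Context (P : probability Omega R) (s : R) (phi : T * T -> R).
Context (N : {RV P >-> nat}) (X : nat -> {RV P >-> T}).
Context (E : nat -> nat -> {RV P >-> bool}).
Hypothesis hG : random_connection_model mu s phi N X E.

(** The index map is arbitrary because the points of a vertex subset and those outside it have to be
    sampled separately. *)
Definition sample n (c : 'I_n -> nat) (w : Omega) : n.-tuple T :=
  [tuple X (c i) w | i < n].

Lemma measurable_sample n (c : 'I_n -> nat) : measurable_fun setT (sample c).
Proof.
apply/measurable_fun_tnthP => i.
rewrite (_ : _ \o _ = X (c i)); first exact: measurable_funPT.
by apply/funext => w /=; rewrite tnth_mktuple.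
Qed.

HB.instance Definition _ n (c : 'I_n -> nat) :=
  isMeasurableFun.Build _ _ _ _ (sample c) (measurable_sample c).

Lemma prob_count_box (S : set nat) n (c : 'I_n -> nat) (B : 'I_n -> set T) :
  injective c -> (forall i, measurable (B i)) ->
  (P (N @^-1` S `&` sample c @^-1` box B) =
   P (N @^-1` S) * \prod_i mu (B i))%E.
Proof.
move=> c_inj mB.
(* One event per index of the independence hypothesis: [None] carries the count, [Some (c i)] the
   i-th side of the box, and indices outside the image of [c] the whole space. *)
pose A (o : option nat) : set Omega := if o is Some j then
  X j @^-1` (if [pick i | c i == j] is Some i then B i else setT)
  else N @^-1` S.
pose t := None :: [seq Some (c i) | i <- enum 'I_n].
have ut : uniq t.
  rewrite /= map_inj_uniq ?enum_uniq => [|i j [] /c_inj //].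
  by rewrite andbT; apply/mapP => -[].
have Ac i : A (Some (c i)) = X (c i) @^-1` B i.
  rewrite /A; case: pickP => [j /eqP /c_inj -> //|/(_ i)].
  by rewrite eqxx.
have /(_ [fset o in t]%fset A) := rcm_indep hG.
have -> : (\prod_(o <- [fset o in t]%fset) P (A o) = \prod_(o <- t) P (A o))%E.
  apply: perm_big; apply: uniq_perm => // o; by rewrite !inE.
rewrite big_cons big_map big_enum /= => indep.
have -> : N @^-1` S `&` sample c @^-1` box B =
    \bigcap_(o in [set` [fset o in t]%fset]) A o.
  apply/seteqP; split => w.
    move=> [Sw Bw] o /=; rewrite !inE => /orP[/eqP -> //|/mapP[i _ ->]].
    by rewrite Ac /=; have := Bw i; rewrite tnth_mktuple.
  move=> Aw; split; first by apply: (Aw None); rewrite /= !inE eqxx.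
  move=> i; rewrite tnth_mktuple.
  have : A (Some (c i)) w by apply: Aw; rewrite /= !inE /=; apply/map_f; rewrite mem_enum.
  by rewrite Ac.
rewrite indep.
  congr (_ * _)%E; apply: eq_bigr => i _.
  by rewrite -(rcm_X hG (c i)) //; congr (P _); exact: Ac.
move=> o; rewrite !inE => /orP[/eqP ->|/mapP[i _ ->]].
  by exists S => //; rewrite setTI.
by rewrite Ac; exists (B i) => //; rewrite setTI.
Qed.

(** The law of n independent positions is read off the given variables, so that no n-fold product
    has to be built; [iid_box] identifies it with the n-fold power of [mu]. *)
Definition iid n : probability (n.-tuple T) R :=
  distribution P (sample (@nat_of_ord n)).

Lemma iid_box n (B : 'I_n -> set T) : (forall i, measurable (B i)) ->
  iid n (box B) = (\prod_i mu (B i))%E.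
Proof.
move=> mB; have := prob_count_box setT (@ord_inj n) mB.
by rewrite preimage_setT setTI probability_setT mul1e.
Qed.

(** As functions of [D] the two sides are finite measures, a restricted law and a multiple of
    [iid n], that agree on boxes. *)
Lemma indep_sample n (c : 'I_n -> nat) (C : set Omega) : measurable C ->
  (forall B : 'I_n -> set T, (forall i, measurable (B i)) ->
    P (C `&` sample c @^-1` box B) = P C * \prod_i mu (B i))%E ->
  forall D, measurable D -> (P (C `&` sample c @^-1` D) = P C * iid n D)%E.
Proof.
move=> mC CB D mD.
have PC0 : 0 <= fine (P C) by apply: fine_ge0.
have PCE : P C = (fine (P C))%:E by rewrite fineK // fin_num_measure.
pose m1 := pushforward (mrestr P mC) (sample c).
pose m2 := mscale (NngNum PC0) (iid n).
have -> : P (C `&` sample c @^-1` D) = m1 D.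
  by rewrite /m1 /pushforward /mrestr setIC.
have -> : (P C * iid n D)%E = m2 D by rewrite /m2 /mscale /= -PCE.
apply: tuple_measure_unique mD => //.
  change (P (setT `&` C) < +oo)%E.
  by rewrite setTI -ge0_fin_numE // fin_num_measure.
move=> B mB.
change (P (sample c @^-1` box B `&` C) = (fine (P C))%:E * iid n (box B))%E.
by rewrite setIC CB // -PCE iid_box.
Qed.

Lemma measurable_count (S : set nat) : measurable (N @^-1` S).
Proof. by rewrite -[X in measurable X]setTI; exact: measurable_funPT. Qed.

Lemma sample_law n (c : 'I_n -> nat) : injective c ->
  forall D, measurable D -> P (sample c @^-1` D) = iid n D.
Proof.
move=> c_inj D mD; have := @indep_sample n c setT measurableT.
rewrite probability_setT => /(_ _ D mD); rewrite setTI mul1e; apply=> B mB.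
have := prob_count_box setT c_inj mB.
by rewrite preimage_setT probability_setT.
Qed.

Lemma prob_count_sample k n (c : 'I_n -> nat) (D : set (n.-tuple T)) :
  injective c -> measurable D ->
  (P (N @^-1` [set k] `&` sample c @^-1` D) = P (N @^-1` [set k]) * iid n D)%E.
Proof.
move=> c_inj mD; apply: indep_sample mD => [|B mB]; first exact: measurable_count.
exact: prob_count_box.
Qed.

(** [indep_sample], applied once to each sample, reduces both sets to boxes; two boxes over disjoint
    indices form one box over the concatenated index map [c2]. *)
Lemma prob_sample2 m n (c : 'I_m -> nat) (c' : 'I_n -> nat)
    (D : set (m.-tuple T)) (D' : set (n.-tuple T)) :
  injective c -> injective c' -> (forall i j, c i != c' j) ->
  measurable D -> measurable D' ->
  (P (sample c @^-1` D `&` sample c' @^-1` D') = iid m D * iid n D')%E.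
Proof.
move=> c_inj c'_inj cc' mD mD'.
have mpre k (b : 'I_k -> nat) A : measurable A -> measurable (sample b @^-1` A).
  by move=> mA; rewrite -[X in measurable X]setTI; exact: measurable_sample.
rewrite -(sample_law c_inj mD); apply: indep_sample mD' => [|B' mB'].
  exact: mpre.
rewrite (sample_law c_inj mD) setIC -(iid_box mB') muleC.
rewrite -(sample_law c'_inj (measurable_box mB')).
apply: indep_sample mD => [|B mB]; first by apply: mpre; exact: measurable_box.
rewrite (sample_law c'_inj (measurable_box mB')) iid_box //.
pose c2 (i : 'I_(n + m)) := match fintype.split i with inl j => c' j | inr j => c j end.
pose B2 (i : 'I_(n + m)) := match fintype.split i with inl j => B' j | inr j => B j end.
have c2_inj : injective c2.
  move=> i j; rewrite /c2.
  case: (split_ordP i) => i' ->; case: (split_ordP j) => j' -> => cij.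
  - by rewrite (c'_inj _ _ cij).
  - by have := cc' j' i'; rewrite cij eqxx.
  - by have := cc' i' j'; rewrite cij eqxx.
  - by rewrite (c_inj _ _ cij).
have mB2 i : measurable (B2 i) by rewrite /B2; case: fintype.split.
have := prob_count_box setT c2_inj mB2.
rewrite preimage_setT setTI probability_setT mul1e big_split_ord /=.
under eq_bigr do rewrite /B2 (unsplitK (inl _)).
under [X in (_ = _ * X)%E]eq_bigr do rewrite /B2 (unsplitK (inr _)).
move=> <-; congr (P _); apply/seteqP; split => w.
  move=> [Bw B'w] i; rewrite tnth_mktuple /c2 /B2.
  case: (split_ordP i) => j _.
    by have := Bw j; rewrite tnth_mktuple.
  by have := B'w j; rewrite tnth_mktuple.
move=> H; split => i; rewrite tnth_mktuple.
  have := H (lshift m i); rewrite tnth_mktuple /c2 /B2.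
  by rewrite (unsplitK (inl i)).
have := H (rshift n i); rewrite tnth_mktuple /c2 /B2.
by rewrite (unsplitK (inr i)).
Qed.

Local Open Scope ereal_scope.

Lemma integral_sample2 m n (c : 'I_m -> nat) (c' : 'I_n -> nat)
    (F : m.-tuple T * n.-tuple T -> \bar R) :
  injective c -> injective c' -> (forall i j, c i != c' j) ->
  measurable_fun setT F -> (forall x, 0 <= F x) ->
  \int[P]_w F (sample c w, sample c' w) =
  \int[iid m]_x \int[iid n]_y F (x, y).
Proof.
move=> c_inj c'_inj cc' mF F0.
have mcc' : measurable_fun setT (fun w => (sample c w, sample c' w)).
  by apply/measurable_fun_pairP; split; exact: measurable_sample.
rewrite -[LHS](ge0_integral_pushforward mcc' P measurableT mF) //.
transitivity (\int[iid m \x iid n]_z F z); last exact: fubini_tonelli1.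
apply: eq_measure_integral => D mD _.
apply/esym/product_measure_unique => // A B mA mB.
exact: prob_sample2.
Qed.

Lemma integral_count_sample k n (c : 'I_n -> nat) (F : n.-tuple T -> \bar R) :
  injective c -> measurable_fun setT F -> (forall x, 0 <= F x) ->
  \int[P]_(w in N @^-1` [set k]) F (sample c w) =
  P (N @^-1` [set k]) * \int[iid n]_x F x.
Proof.
move=> c_inj mF F0.
have mNk := measurable_count [set k].
have PC0 : (0 <= fine (P (N @^-1` [set k])))%R by apply: fine_ge0.
rewrite -[P _]fineK ?fin_num_measure //.
rewrite -[RHS](ge0_integral_mscale _ _ (NngNum PC0)) //.
rewrite -(ge0_integral_mrestr P mNk) //; last first.
  exact/(measurableT_comp mF)/measurable_sample.
rewrite -[LHS](ge0_integral_pushforward (measurable_sample c) _ measurableT mF) //.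
apply: eq_measure_integral => D mD _.
change (P (sample c @^-1` D `&` N @^-1` [set k]) =
  (fine (P (N @^-1` [set k])))%:E * iid n D).
rewrite fineK ?fin_num_measure //.
by rewrite -(prob_count_sample _ c_inj mD) setIC.
Qed.

End independence_of_positions.

Section graph_mean.
Context {d : measure_display} {T : measurableType d} {R : realType}.
Context (mu : probability T R) (phi : T * T -> R).
Hypothesis hphi : connection_function phi.

(** Entries without i < j are deterministic coins equal to [false]: the weights still sum to 1, and
    each graph has at most one code of nonzero weight. *)
Definition edge_weight n (x : n.-tuple T) (p : 'I_n * 'I_n) (y : bool) : R :=
  if (p.1 < p.2)%N then
    if y then phi (tnth x p.1, tnth x p.2) else 1 - phi (tnth x p.1, tnth x p.2)
  else (~~ y)%:R.

Definition graph_mean n (F : graph n -> R) (x : n.-tuple T) : R :=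
  bern (edge_weight x) F.

Lemma edge_weight_sum1 n (x : n.-tuple T) p :
  edge_weight x p true + edge_weight x p false = 1.
Proof. by rewrite /edge_weight; case: ifP => _; rewrite ?add0r // addrC subrK. Qed.

Lemma edge_weight_ge0 n (x : n.-tuple T) p y : 0 <= edge_weight x p y.
Proof.
rewrite /edge_weight; case: ifP => // _.
by have /andP[? ?] := cf_01 hphi (tnth x p.1, tnth x p.2); case: y; rewrite ?subr_ge0.
Qed.

Definition subtuple m n (c : 'I_m -> 'I_n) (x : n.-tuple T) : m.-tuple T :=
  [tuple tnth x (c i) | i < m].

Lemma edge_weight_subtuple m n (c : 'I_m -> 'I_n) (x : n.-tuple T) :
  increasing c ->
  edge_weight x \o (fun p => (c p.1, c p.2)) = edge_weight (subtuple c x).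
Proof.
move=> cI; apply/funext => p; apply/funext => y.
by rewrite /edge_weight /= cI !tnth_mktuple.
Qed.

Lemma pair_map_inj (I J : Type) (c : I -> J) : injective c ->
  injective (fun p => (c p.1, c p.2)).
Proof. by move=> c_inj [i j] [i' j'] [/c_inj -> /c_inj ->]. Qed.

Lemma graph_mean_pull2 m l n (c : 'I_m -> 'I_n) (c' : 'I_l -> 'I_n) F F' x :
  increasing c -> increasing c' -> (forall i j, c i != c' j) ->
  graph_mean (fun g => F (pull c g) * F' (pull c' g)) x =
  graph_mean F (subtuple c x) * graph_mean F' (subtuple c' x).
Proof.
move=> cI cI' cc'; rewrite /graph_mean -!edge_weight_subtuple //.
apply: bern_reindex2.
- exact: edge_weight_sum1.
- exact/pair_map_inj/increasing_inj.
- exact/pair_map_inj/increasing_inj.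
- by move=> p q; rewrite xpair_eqE negb_and cc'.
Qed.

Lemma graph_mean_ge0 n (F : graph n -> R) x :
  (forall g, 0 <= F g) -> 0 <= graph_mean F x.
Proof. by move=> F0; apply: bern_ge0 => // p y; exact: edge_weight_ge0. Qed.

(** The coin of the pair joining [u] and [v] is not read by the graph without [v], so the mean
    factorises; [e] is the entry, smaller index first, that codes this pair. *)
Lemma graph_mean_extend m (v : 'I_m.+1) (u : 'I_m) (F : graph m -> R) x :
  graph_mean (fun g => F (pull (lift v) g) * (adj g (lift v u) v)%:R) x =
  graph_mean F (subtuple (lift v) x) * phi (tnth x (lift v u), tnth x v).
Proof.
pose e := if (lift v u < v)%N then (lift v u, v) else (v, lift v u).
have lI : increasing (lift v) by move=> i j; rewrite /= !ltnNge leq_bump2.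
have uv : lift v u != v by rewrite eq_sym neq_lift.
have e_lt : (e.1 < e.2)%N.
  rewrite /e; case: ifP => //=; move: uv.
  by rewrite -val_eqE /=; case: ltngtP.
transitivity (graph_mean (fun g => F (pull (lift v) g) *
    (fun h : {ffun unit -> bool} => (h tt)%:R)
      (reindex_ffun (fun=> e) g)) x).
  by congr (bern _ _); apply/funext => g; rewrite /adj uv ffunE.
rewrite /graph_mean (@bern_reindex2 _ _ _ unit _
  (fun p => (lift v p.1, lift v p.2)) (fun=> e) F (fun h => (h tt)%:R)).
- rewrite edge_weight_subtuple // bern_at; last by move=> i; exact: edge_weight_sum1.
  congr (_ * _); rewrite /= /edge_weight e_lt /e.
  by case: ifP => _ //=; rewrite (cf_sym hphi).
- exact: edge_weight_sum1.
- exact/pair_map_inj/increasing_inj.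
- by move=> [] [].
- move=> p _; rewrite /e; case: ifP => _; rewrite xpair_eqE negb_and.
    by rewrite [_ == v]eq_sym neq_lift orbT.
  by rewrite [_ == v]eq_sym neq_lift.
Qed.

Lemma measurable_edge_weight n p y :
  measurable_fun setT (fun x : n.-tuple T => edge_weight x p y).
Proof.
have mphi : measurable_fun setT
    (fun x : n.-tuple T => phi (tnth x p.1, tnth x p.2)).
  apply: (measurableT_comp (cf_measurable hphi)).
  by apply/measurable_fun_pairP; split; exact: measurable_tnth.
rewrite /edge_weight; case: (p.1 < p.2)%N => //; case: y => //.
exact: measurable_funB.
Qed.

Lemma measurable_graph_mean n (F : graph n -> R) :
  measurable_fun setT (graph_mean F).
Proof.
apply: measurable_sum => g; apply: measurable_funM => //.
by apply: measurable_prod => p _; exact: measurable_edge_weight.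
Qed.

Lemma measurable_EFin_graph_mean n (F : graph n -> R) :
  measurable_fun setT (EFin \o graph_mean F).
Proof. by apply/measurable_EFinP; exact: measurable_graph_mean. Qed.

End graph_mean.

Section mean_over_positions.
Context {d : measure_display} {T : measurableType d} {R : realType}.
Context (mu : probability T R).
Context {dO : measure_display} {Omega : measurableType dO}.
Context (P : probability Omega R) (s : R) (phi : T * T -> R).
Context (N : {RV P >-> nat}) (X : nat -> {RV P >-> T}).
Context (E : nat -> nat -> {RV P >-> bool}).
Hypothesis hG : random_connection_model mu s phi N X E.
Hypothesis hphi : connection_function phi.
Local Open Scope ereal_scope.
Local Notation iid := (iid X).
Local Notation sample := (sample X).
Local Notation graph_mean := (graph_mean phi).

Definition En n (F : graph n -> R) : \bar R := \int[iid n]_x (graph_mean F x)%:E.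

Let mgm n (F : graph n -> R) : measurable_fun setT (EFin \o graph_mean F).
Proof. exact: measurable_EFin_graph_mean. Qed.

Lemma En_ge0 n (F : graph n -> R) : (forall g, 0 <= F g)%R -> 0 <= En F.
Proof.
by move=> F0; apply: integral_ge0 => x _; rewrite lee_fin graph_mean_ge0.
Qed.

Lemma le_En n (F F' : graph n -> R) : (forall g, 0 <= F g)%R ->
  (forall g, F g <= F' g)%R -> En F <= En F'.
Proof.
move=> F0 FF'; apply: ge0_le_integral => //.
- by move=> x _; rewrite lee_fin graph_mean_ge0.
- exact: mgm.
- exact: mgm.
- move=> x _; rewrite lee_fin le_bern // => p y; exact: edge_weight_ge0.
Qed.

Lemma En1 n : @En n (fun=> 1%R) = 1.
Proof.
rewrite /En (eq_integral (fun=> 1)); last first.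
  by move=> x _; rewrite /graph_mean bern1 //; exact: edge_weight_sum1.
by rewrite integral_cst // mul1e; exact: probability_setT.
Qed.

Lemma En_sum (I : finType) (D : pred I) n (F : I -> graph n -> R) :
  (forall i g, 0 <= F i g)%R ->
  En (fun g => \sum_(i | D i) F i g)%R = \sum_(i | D i) En (F i).
Proof.
move=> F0; rewrite /En.
under eq_integral do rewrite /graph_mean bern_sum -sumEFin -big_filter.
rewrite ge0_integral_sum //; first by rewrite big_filter.
- by move=> i; exact: mgm.
- by move=> i x _; rewrite lee_fin graph_mean_ge0.
Qed.

Let measurable_mean_subtuple m n (c : 'I_m -> 'I_n) (F : graph m -> R) :
  measurable_fun setT (fun x => (graph_mean F (subtuple c x))%:E).
Proof.
apply: (measurableT_comp (mgm F)); apply/measurable_fun_tnthP => i.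
rewrite (_ : _ \o _ = (@tnth n T)^~ (c i)); first exact: measurable_tnth.
by apply/funext => x /=; rewrite tnth_mktuple.
Qed.

Let measurable_mean_fst m n (F : graph m -> R) :
  measurable_fun setT
    (fun z : m.-tuple T * n.-tuple T => (graph_mean F z.1)%:E).
Proof. exact: (measurableT_comp (mgm F) measurable_fst). Qed.

Let measurable_mean_snd m n (F : graph n -> R) :
  measurable_fun setT
    (fun z : m.-tuple T * n.-tuple T => (graph_mean F z.2)%:E).
Proof. exact: (measurableT_comp (mgm F) measurable_snd). Qed.

(** Independence of the graphs on two disjoint vertex sets: first for the edges at fixed positions,
    then for the positions, as two disjoint samples. *)
Lemma En_pull2 m l n (c : 'I_m -> 'I_n) (c' : 'I_l -> 'I_n) F F' :
  increasing c -> increasing c' -> (forall i j, c i != c' j) ->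
  (forall g, 0 <= F g)%R -> (forall g, 0 <= F' g)%R ->
  En (fun g => F (pull c g) * F' (pull c' g))%R = En F * En F'.
Proof.
move=> cI cI' cc' F0 F'0; rewrite /En.
under eq_integral do rewrite graph_mean_pull2 // EFinM.
rewrite ge0_integral_distribution; last 2 first.
- by apply: emeasurable_funM; exact: measurable_mean_subtuple.
- by move=> x; rewrite mule_ge0 // lee_fin graph_mean_ge0.
pose f m (c : 'I_m -> 'I_n) (i : 'I_m) := c i : nat.
have fI k (b : 'I_k -> 'I_n) : increasing b -> injective (f _ b).
  by move=> bI i j /val_inj /(increasing_inj bI).
have subE k (b : 'I_k -> 'I_n) w :
    subtuple b (sample (@nat_of_ord n) w) = sample (f _ b) w.
  by apply: eq_from_tnth => i; rewrite !tnth_mktuple.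
transitivity (\int[P]_w ((graph_mean F (sample (f _ c) w))%:E *
    (graph_mean F' (sample (f _ c') w))%:E)).
  by apply: eq_integral => w _; rewrite /= !subE.
rewrite (integral_sample2 hG
  (F := fun z => (graph_mean F z.1)%:E * (graph_mean F' z.2)%:E)); first last.
- by move=> z; rewrite mule_ge0 // lee_fin graph_mean_ge0.
- by apply: emeasurable_funM;
    [exact: measurable_mean_fst|exact: measurable_mean_snd].
- by move=> i j; rewrite /f val_eqE.
- exact: fI.
- exact: fI.
transitivity (\int[iid m]_x ((graph_mean F x)%:E * En F')).
  apply: eq_integral => x _ /=; rewrite /En -ge0_integralZl //.
  - exact: mgm.
  - by move=> y _; rewrite lee_fin graph_mean_ge0.
  - by rewrite lee_fin graph_mean_ge0.
rewrite ge0_integralZr //.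
- exact: mgm.
- by move=> y _; rewrite lee_fin graph_mean_ge0.
- exact: En_ge0.
Qed.

Lemma En_pull m n (c : 'I_m -> 'I_n) F : increasing c ->
  (forall g, 0 <= F g)%R -> En (fun g => F (pull c g)) = En F.
Proof.
(* An empty second vertex set reduces the claim to the product rule. *)
move=> cI F0; pose c' (i : 'I_0) : 'I_n := widen_ord (leq0n n) i.
have cI' : increasing c' by move=> [].
have cc' i j : c i != c' j by case: j.
rewrite -[RHS]mule1 -(En1 0) -(En_pull2 cI cI' cc' F0) //.
by congr (En _); apply/funext => g; rewrite mulr1.
Qed.

(** Only the edge to [u] reads the position of [v]; integrating this position out leaves the mean
    connection at [u]. *)
Lemma En_extend m (v : 'I_m.+1) (u : 'I_m) (F : graph m -> R) :
  (forall g, 0 <= F g)%R ->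
  En (fun g => F (pull (lift v) g) * (adj g (lift v u) v)%:R)%R =
  \int[iid m]_x ((graph_mean F x)%:E * mean_connection mu phi (tnth x u)).
Proof.
move=> F0; rewrite /En.
under eq_integral do rewrite graph_mean_extend // EFinM.
have mphi : measurable_fun setT (EFin \o phi).
  by apply/measurable_EFinP; exact: cf_measurable hphi.
have phi0 z : 0 <= (phi z)%:E by rewrite lee_fin; case/andP: (cf_01 hphi z).
rewrite ge0_integral_distribution; last 2 first.
- apply: emeasurable_funM; first exact: measurable_mean_subtuple.
  by apply: (measurableT_comp mphi); apply/measurable_fun_pairP; split;
    exact: measurable_tnth.
- by move=> x; rewrite mule_ge0 // lee_fin graph_mean_ge0.
pose c (i : 'I_m) := lift v i : nat.
pose c' (i : 'I_1) := v : nat.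
transitivity (\int[P]_w ((graph_mean F (sample c w))%:E *
    (phi (tnth (sample c w) u, tnth (sample c' w) ord0))%:E)).
  apply: eq_integral => w _ /=; rewrite !tnth_mktuple; congr (_%:E * _).
  by congr (graph_mean F _); apply: eq_from_tnth => i; rewrite !tnth_mktuple.
rewrite (integral_sample2 hG
  (F := fun z => (graph_mean F z.1)%:E * (phi (tnth z.1 u, tnth z.2 ord0))%:E));
  first last.
- by move=> z; rewrite mule_ge0 // lee_fin graph_mean_ge0.
- apply: emeasurable_funM; first exact: measurable_mean_fst.
  apply: (measurableT_comp mphi); apply/measurable_fun_pairP; split.
    exact: (measurableT_comp (@measurable_tnth _ _ _ _) measurable_fst).
  exact: (measurableT_comp (@measurable_tnth _ _ _ _) measurable_snd).
- by move=> i j; rewrite /c /c' val_eqE eq_sym neq_lift.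
- by move=> i j _; rewrite !ord1.
- by move=> i j /val_inj /lift_inj.
apply: eq_integral => x _ /=.
have mphix : measurable_fun setT (fun y => (phi (tnth x u, y))%:E).
  by apply: (measurableT_comp mphi); exact: pair1_measurable.
rewrite ge0_integralZl //; last 2 first.
- by apply: (measurableT_comp mphix); exact: measurable_tnth.
- by rewrite lee_fin graph_mean_ge0.
congr (_ * _); rewrite ge0_integral_distribution //; last first.
  by apply: (measurableT_comp mphix); exact: measurable_tnth.
transitivity (\int[distribution P (X 0%N)]_y (phi (tnth x u, y))%:E).
  rewrite ge0_integral_distribution //.
  by apply: eq_integral => w _ /=; rewrite tnth_mktuple.
by apply: eq_measure_integral => A mA _; exact: (rcm_X hG 0%N).
Qed.

Definition conn_prob m : \bar R :=
  En (fun g : graph m => (induced_connected (adj g) finset.setT)%:R).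

Lemma conn_prob_ge0 m : 0 <= conn_prob m.
Proof. by apply: En_ge0 => g; rewrite ler0n. Qed.

Lemma conn_prob_le1 m : conn_prob m <= 1.
Proof.
rewrite -(En1 m); apply: le_En => g; first by rewrite ler0n.
by rewrite lern1 leq_b1.
Qed.

Lemma conn_prob_fin_num m : conn_prob m \is a fin_num.
Proof.
rewrite ge0_fin_numE ?conn_prob_ge0 //.
exact: le_lt_trans (conn_prob_le1 m) (ltry _).
Qed.

Lemma lift_increasing m (v : 'I_m.+1) : increasing (lift v).
Proof. by move=> i j; rewrite /= !ltnNge leq_bump2. Qed.

Lemma imset_liftT m (v : 'I_m.+1) : (lift v @: finset.setT = [set~ v])%SET.
Proof.
apply/finset.setP => x; rewrite !inE; apply/imsetP/idP => [[i _ ->]|].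
  by rewrite eq_sym neq_lift.
by rewrite eq_sym => /unlift_some[i -> _]; exists i.
Qed.

Lemma measurable_mean_connection :
  measurable_fun setT (mean_connection mu phi).
Proof.
apply: (@measurable_fun_fubini_tonelli_F _ _ _ _ _ mu (EFin \o phi)).
  by apply/measurable_EFinP; exact: cf_measurable hphi.
by move=> z; rewrite lee_fin; case/andP: (cf_01 hphi z).
Qed.

Lemma mean_connection_ge0 x : 0 <= mean_connection mu phi x.
Proof.
by apply: integral_ge0 => y _; rewrite lee_fin; case/andP: (cf_01 hphi (x, y)).
Qed.

Lemma mean_connection_le1 x : mean_connection mu phi x <= 1.
Proof.
rewrite -(probability_setT mu) -[leRHS]mul1e -(integral_cst mu measurableT 1).
apply: ge0_le_integral => //.
- by move=> y _; rewrite lee_fin; case/andP: (cf_01 hphi (x, y)).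
- apply/measurable_EFinP/(measurableT_comp (cf_measurable hphi)).
  exact: pair1_measurable.
- by move=> y _; rewrite lee_fin; case/andP: (cf_01 hphi (x, y)).
Qed.

Let Msup := ereal_sup (range (mean_connection mu phi)).
Let Minf := ereal_inf (range (mean_connection mu phi)).

Lemma sup_mean_connection_bound : 0 <= Msup <= 1.
Proof.
(* A space of mass 1 has a point; over an empty one the supremum would be -oo. *)
have [x _] : [set: T] !=set0.
  apply/set0P/eqP => T0; have := probability_setT mu.
  by rewrite T0 measure0 => /eqP; rewrite eq_sym onee_eq0.
apply/andP; split.
  apply: le_trans (mean_connection_ge0 x) _.
  by apply: ereal_sup_ubound; exists x.
by apply: ge_ereal_sup => _ [y _ <-]; exact: mean_connection_le1.
Qed.

Lemma inf_mean_connection_ge0 : 0 <= Minf.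
Proof. by apply: le_ereal_inf_tmp => _ [y _ <-]; exact: mean_connection_ge0. Qed.

Let conn k (g : graph k) : R := (induced_connected (adj g) finset.setT)%:R.
Let conn0 k (g : graph k) : (0 <= conn g)%R. Proof. by rewrite ler0n. Qed.

Let measurable_conn_mean m (u : 'I_m) : measurable_fun setT
  (fun x => (graph_mean (@conn m) x)%:E * mean_connection mu phi (tnth x u)).
Proof.
apply: emeasurable_funM; first exact: mgm.
exact: (measurableT_comp measurable_mean_connection (@measurable_tnth _ _ _ _)).
Qed.

(** Union bound over the (m + 1) m choices of a vertex [v] that can be deleted without disconnecting
    the rest and of a neighbour [u] of it. The position of [v] integrates to at most [Msup]. *)
Lemma conn_probS_le m : (0 < m)%N ->
  conn_prob m.+1 <= (m.+1 * m)%:R%:E * (conn_prob m * Msup).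
Proof.
move=> m0; have /andP[Msup0 _] := sup_mean_connection_bound.
pose F (p : 'I_m.+1 * 'I_m) (g : graph m.+1) : R :=
  (conn (pull (lift p.1) g) * (adj g (lift p.1 p.2) p.1)%:R)%R.
have F0 p g : (0 <= F p g)%R by rewrite mulr_ge0 // ler0n.
apply: (@le_trans _ _ (En (fun g => \sum_p F p g)%R)).
  apply: le_En => // g; case: (boolP (induced_connected _ _)) => [cg|_].
    have [|u [v [uv euv cv]]] := connected_removable (adj_sym g) _ cg.
      by rewrite card_ord.
    have [|i ui _] := @unlift_some _ v u; first by rewrite eq_sym.
    rewrite (bigD1 (v, i)) //= ler_wpDr ?sumr_ge0 //.
    rewrite /F /conn /= induced_connected_pull; last exact: lift_increasing.
    by rewrite imset_liftT cv -ui euv mulr1.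
  exact: sumr_ge0.
rewrite En_sum //.
apply: (@le_trans _ _ (\sum_(p : 'I_m.+1 * 'I_m) conn_prob m * Msup)).
  apply: lee_sum => -[v u] _; rewrite (En_extend v u (@conn0 m)).
  rewrite /conn_prob /En -ge0_integralZr //; first last.
  - by move=> x _; rewrite lee_fin graph_mean_ge0.
  - exact: mgm.
  apply: ge0_le_integral => //.
  - move=> x _; rewrite mule_ge0 ?mean_connection_ge0 //.
    by rewrite lee_fin graph_mean_ge0.
  - exact: measurable_conn_mean.
  - by apply: emeasurable_funM; [exact: mgm|exact: measurable_cst].
  - move=> x _; apply: lee_wpmul2l; first by rewrite lee_fin graph_mean_ge0.
    by apply: ereal_sup_ubound; exists (tnth x u).
by rewrite sumr_const card_prod !card_ord mule_natl.
Qed.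

(** One way of being connected suffices: the last vertex is joined to vertex 0, and the others are
    connected among themselves. *)
Lemma conn_probS_ge m : (0 < m)%N -> conn_prob m * Minf <= conn_prob m.+1.
Proof.
move=> m0; pose u := Ordinal m0; have Minf0 := inf_mean_connection_ge0.
apply: (@le_trans _ _ (En (fun g : graph m.+1 =>
    conn (pull (lift ord_max) g) * (adj g (lift ord_max u) ord_max)%:R)%R)).
  rewrite (En_extend ord_max u (@conn0 m)).
  rewrite /conn_prob /En -ge0_integralZr //; first last.
  - by move=> x _; rewrite lee_fin graph_mean_ge0.
  - exact: mgm.
  apply: ge0_le_integral => //.
  - by move=> x _; rewrite mule_ge0 // lee_fin graph_mean_ge0.
  - by apply: emeasurable_funM; [exact: mgm|exact: measurable_cst].
  - exact: measurable_conn_mean.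
  - move=> x _; apply: lee_wpmul2l; first by rewrite lee_fin graph_mean_ge0.
    by apply: ereal_inf_lbound; exists (tnth x u).
apply: le_En => g; first by rewrite mulr_ge0 // ler0n.
rewrite /conn induced_connected_pull; last exact: lift_increasing.
rewrite imset_liftT.
case: (boolP (induced_connected _ [set~ ord_max]%SET)) => c; last first.
  by rewrite mul0r ler0n.
case: (boolP (adj _ _ _)) => a; last by rewrite mulr0 ler0n.
rewrite mulr1 -[finset.setT](finset.setUCr [set ord_max]%SET).
rewrite (@induced_connected_add _ _ (adj_sym g) _ (lift ord_max u)) //.
by rewrite !inE eq_sym neq_lift.
Qed.

Lemma conn_prob1 : conn_prob 1 = 1.
Proof.
rewrite -(En1 1); congr (En _); apply/funext => g.
rewrite (_ : finset.setT = [set ord0]%SET) ?induced_connected1 //.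
by apply/finset.setP => i; rewrite !inE ord1.
Qed.

End mean_over_positions.

(** * The Stein bound for the Poisson process *)

Section poisson_shift.
Context {R : realType}.
Local Open Scope ereal_scope.

(** Marking [k] of [n + k] Poisson points leaves, up to a constant factor, the Poisson weight of the
    [n] others; this is the analytic content of the Palm identity. *)
Lemma poisson_pmf_shift (s : R) k n : (0 < s)%R ->
  (poisson_pmf s (n + k) * 'C(n + k, k)%:R = s ^+ k / k`!%:R * poisson_pmf s n)%R.
Proof.
move=> s0; rewrite /poisson_pmf s0 exprD.
have /(congr1 (fun n => n%:R : R)) : ('C(n + k, k) * (k`! * n`!) = (n + k)`!)%N.
  by rewrite -[in n`!%N](addnK k n) bin_fact // leq_addl.
rewrite !natrM => <-.
have k0 : (k`!%:R : R) != 0%R by rewrite pnatr_eq0 -lt0n fact_gt0.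
have n0 : (n`!%:R : R) != 0%R by rewrite pnatr_eq0 -lt0n fact_gt0.
have c0 : ('C(n + k, k)%:R : R) != 0%R.
  by rewrite pnatr_eq0 -lt0n bin_gt0 leq_addl.
by field; rewrite k0 n0 c0.
Qed.

Lemma poisson_series_shift (s : R) k (a : nat -> \bar R) : (0 < s)%R ->
  (forall n, 0 <= a n) ->
  \sum_(n <oo) (poisson_pmf s n)%:E * ('C(n, k)%:R%:E * a (n - k)%N) =
  (s ^+ k / k`!%:R)%:E * \sum_(n <oo) (poisson_pmf s n)%:E * a n.
Proof.
move=> s0 a0; have p0 n := poisson_pmf_ge0 s n.
rewrite (nneseries_split 0 k); last first.
  by move=> n _; rewrite mule_ge0 ?mule_ge0 ?lee_fin ?p0.
rewrite big1_seq ?add0e => [|n]; last first.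
  rewrite mem_index_iota /= add0n => nk.
  by rewrite bin_small // mul0e mule0.
rewrite add0n -nneseries_addn; last first.
  by move=> n; rewrite mule_ge0 ?mule_ge0 ?lee_fin ?p0.
rewrite -nneseriesZl; last by move=> n _; rewrite mule_ge0 ?lee_fin ?p0.
apply: eq_eseriesr => n _; rewrite addnK !muleA -!EFinM.
by rewrite poisson_pmf_shift.
Qed.

End poisson_shift.

Section expectation_over_graphs.
Context {d : measure_display} {T : measurableType d} {R : realType}.
Context (mu : probability T R).
Context {dO : measure_display} {Omega : measurableType dO}.
Context (P : probability Omega R) (s : R) (phi : T * T -> R).
Context (N : {RV P >-> nat}) (X : nat -> {RV P >-> T}).
Context (E : nat -> nat -> {RV P >-> bool}).
Hypothesis hG : random_connection_model mu s phi N X E.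
Hypothesis hphi : connection_function phi.
Hypothesis s_gt0 : 0 < s.
Local Open Scope ereal_scope.
Local Notation iid := (iid X).
Local Notation sample := (sample X).
Local Notation En := (En phi X).

(** The mask clears the entries that [edge_weight] forces to be [false]. *)
Definition graph_of n (w : Omega) : graph n :=
  [ffun p : 'I_n * 'I_n => (p.1 < p.2)%N && E p.1 p.2 w].

Definition random_graph (w : Omega) : graph (N w) := graph_of (N w) w.

Lemma adj_graph_of n w : adj (graph_of n w) = (fun i j : 'I_n => E i j w).
Proof.
apply/funext => i; apply/funext => j; rewrite /adj ffunE.
have [<-|ij] := eqVneq i j; first by rewrite (rcm_irr hG).
case: (ltngtP i j) ij => [ij|ij|/val_inj ->]; last by rewrite eqxx.
  by rewrite /= ij.
by rewrite /= ij (rcm_sym hG).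
Qed.

Lemma rcm_HE k w : rcm_H N E k w = conn_subgraphs k (adj (random_graph w)).
Proof. by rewrite /rcm_H adj_graph_of. Qed.

Lemma measurable_graph_of n (g : graph n) : measurable [set w | graph_of n w = g].
Proof.
rewrite (_ : [set w | _] =
    \bigcap_(p in [set: 'I_n * 'I_n])
      [set w | (p.1 < p.2)%N && E p.1 p.2 w = g p]); last first.
  apply/seteqP; split => [w <- p _|w H]; first by rewrite /= ffunE.
  by apply/ffunP => p; rewrite ffunE; exact: H.
apply: fin_bigcap_measurable => [|p _]; first exact: finite_finset.
rewrite -[X in measurable X]setTI; case: (p.1 < p.2)%N.
  exact: (@measurable_funPT _ _ _ _ (E p.1 p.2) measurableT [set g p]).
exact: (@measurable_cst _ _ _ bool setT false measurableT [set g p]).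
Qed.

(** [N] takes countably many values and each leaves finitely many codes, so every property of the
    graph is an event. *)
Lemma measurable_graph_event (Q : forall n, graph n -> Prop) :
  measurable [set w | Q (N w) (random_graph w)].
Proof.
rewrite (_ : [set w | _] = \bigcup_n (N @^-1` [set n] `&`
    \bigcup_(g in [set g | Q n g]) [set w | graph_of n w = g])).
  apply: bigcupT_measurable => n; apply: measurableI.
    exact: measurable_count.
  apply: fin_bigcup_measurable => [|g _]; first exact: finite_finset.
  exact: measurable_graph_of.
apply/seteqP; split => [w Qw|w [n _ [/= <- [g Qg gw]]]]; last first.
  by rewrite /= /random_graph gw.
by exists (N w) => //; split => //; exists (random_graph w).
Qed.

Lemma measurable_graph_fun (F : forall n, graph n -> R) :
  measurable_fun setT (fun w => F (N w) (random_graph w)).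
Proof.
by move=> _ Y mY; rewrite setTI; exact: (measurable_graph_event (fun n g => Y (F n g))).
Qed.

Lemma prob_count n : P (N @^-1` [set n]) = (poisson_pmf s n)%:E.
Proof.
transitivity (distribution P N [set n]) => //.
rewrite (rcm_N hG) /poisson_prob s_gt0 esum_set1 //.
by rewrite lee_fin poisson_pmf_ge0.
Qed.

Lemma prob_graph n (g : graph n) :
  P (N @^-1` [set n] `&` [set w | graph_of n w = g]) =
  (poisson_pmf s n)%:E * \int[iid n]_x (\prod_p edge_weight phi x p (g p))%:E.
Proof.
(* A code with an edge outside the entries i < j never occurs and has weight 0. Any other code is
   determined by [adj], and the conditional law applies with the positions unrestricted. *)
have [gU|] := pselect (forall p : 'I_n * 'I_n, g p -> (p.1 < p.2)%N); last first.
  move=> /existsNP[p] /not_implyP[gp pn].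
  rewrite (_ : _ `&` _ = set0) ?measure0; last first.
    apply/seteqP; split => // w [_ /= gw]; apply: pn.
    by move: gp; rewrite -gw ffunE => /andP[].
  rewrite (eq_integral (fun=> 0)) ?integral0 ?mule0 // => x _.
  by rewrite (bigD1 p) //= /edge_weight ifN ?gp ?mul0r //; apply/negP.
have := rcm_cond hG (adj g) (@measurableT _ (n.-tuple T)).
set A := [set w | N w = n /\ _]; have -> : A = N @^-1` [set n].
  by apply/seteqP; split => w //= -[].
have -> : [set w | forall i j : 'I_n, (i < j)%N -> E i j w = adj g i j] =
    [set w | graph_of n w = g].
  apply/seteqP; split => [w H|w /= <- i j ij]; last by rewrite adj_graph_of.
  apply/ffunP => -[i j]; rewrite ffunE /=.
  case: (ltnP i j) => ij /=.
    rewrite H // /adj ij; case: eqVneq => //= ij'.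
    by rewrite ij' ltnn in ij.
  by apply/esym/negbTE/negP => /gU /=; rewrite ltnNge ij.
move=> ->; rewrite -prob_count -(integral_count_sample hG _ (@ord_inj n)) //.
- apply: eq_integral => w _; congr (_%:E).
  rewrite pair_big_dep /= big_mkcond /=; apply: eq_bigr => -[i j] _ /=.
  rewrite /edge_weight /=; case: ifP => ij; last first.
    by case gij: (g (i, j)) => //=; have := gU _ gij; rewrite /= ij.
  by rewrite !tnth_mktuple /adj ij; case: eqVneq => // ij'; rewrite ij' ltnn in ij.
- apply/measurable_EFinP/measurable_prod => p _.
  exact: measurable_edge_weight.
- move=> x; rewrite lee_fin prodr_ge0 // => p _; exact: edge_weight_ge0.
Qed.

Lemma expectation_graph (F : forall n, graph n -> R) :
  (forall n g, 0 <= F n g)%R ->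
  \int[P]_w (F (N w) (random_graph w))%:E =
  \sum_(n <oo) (poisson_pmf s n)%:E * En (F n).
Proof.
move=> F0.
have NT : \bigcup_n (N @^-1` [set n]) = setT.
  by apply/seteqP; split => // w _; exists (N w).
rewrite -NT ge0_integral_bigcup //; first last.
- by apply/trivIsetP => i j _ _ /eqP ij; apply/seteqP; split => // w [/= ->].
- by move=> w _; rewrite lee_fin.
- by rewrite NT; apply/measurable_EFinP; exact: measurable_graph_fun.
- by move=> n; exact: measurable_count.
apply: eq_eseriesr => n _.
transitivity (\int[P]_(w in N @^-1` [set n])
    (\sum_g (F n g)%:E * (\1_[set w | graph_of n w = g] w)%:E)).
  apply: eq_integral => w; rewrite inE /= => <-.
  rewrite (bigD1 (random_graph w)) //= indicE mem_set // mule1 big1 ?adde0 //.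
  move=> g gn; rewrite indicE memNset ?mule0 //= => gw.
  by rewrite /random_graph gw eqxx in gn.
rewrite ge0_integral_sum //; first last.
- by move=> g w _; rewrite mule_ge0 // lee_fin.
- move=> g; apply: emeasurable_funM => //; apply/measurable_EFinP.
  by apply: measurable_funTS; exact: measurable_indic (measurable_graph_of g).
- exact: measurable_count.
rewrite /En; under [in RHS]eq_integral do rewrite /graph_mean /bern -sumEFin.
rewrite ge0_integral_sum //; first last.
- move=> g x _; rewrite lee_fin mulr_ge0 // prodr_ge0 // => p _.
  exact: edge_weight_ge0.
- move=> g; apply/measurable_EFinP/measurable_funM => //.
  by apply: measurable_prod => p _; exact: measurable_edge_weight.
rewrite ge0_sume_distrr; last first.
  move=> g _; apply: integral_ge0 => x _; rewrite lee_fin mulr_ge0 // prodr_ge0 // => p _.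
  exact: edge_weight_ge0.
apply: eq_bigr => g _; rewrite ge0_integralZl_EFin //; first last.
- by apply/measurable_EFinP; apply: measurable_funTS;
    exact: measurable_indic (measurable_graph_of g).
- exact: measurable_count.
rewrite integral_indic; [|exact: measurable_count|exact: measurable_graph_of].
rewrite setIC; transitivity ((F n g)%:E * ((poisson_pmf s n)%:E *
    \int[iid n]_x (\prod_p edge_weight phi x p (g p))%:E)).
  by congr (_ * _); exact: prob_graph.
rewrite muleCA; congr (_ * _).
rewrite -ge0_integralZl_EFin //; first last.
- by apply/measurable_EFinP/measurable_prod => p _; exact: measurable_edge_weight.
- by move=> x _; rewrite lee_fin prodr_ge0 // => p _; exact: edge_weight_ge0.
by apply: eq_integral => x _; rewrite -EFinM mulrC.
Qed.

End expectation_over_graphs.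

Section stein_bound.
Context {d : measure_display} {T : measurableType d} {R : realType}.
Context (mu : probability T R).
Context {dO : measure_display} {Omega : measurableType dO}.
Context (P : probability Omega R) (s : R) (phi : T * T -> R).
Context (N : {RV P >-> nat}) (X : nat -> {RV P >-> T}).
Context (E : nat -> nat -> {RV P >-> bool}).
Hypothesis hG : random_connection_model mu s phi N X E.
Hypothesis hphi : connection_function phi.
Hypothesis s_gt0 : 0 < s.
Local Open Scope ereal_scope.
Local Notation En := (En phi X).
Local Notation cprob := (conn_prob phi X).
Local Notation G := (random_graph N E).

Lemma En_induced_connected n (A : {set 'I_n}) m : #|A| = m ->
  En (fun g => (induced_connected (adj g) A)%:R) = cprob m.
Proof.
move=> /increasing_enum[c [cI <-]].
rewrite /conn_prob -(En_pull hG hphi cI); last by move=> g; rewrite ler0n.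
by congr (En _); apply/funext => g; rewrite induced_connected_pull.
Qed.

Lemma sum_card_const n m (a : \bar R) :
  \sum_(A : {set 'I_n} | #|A| == m) a = 'C(n, m)%:R%:E * a.
Proof.
rewrite (eq_bigl (fun A : {set 'I_n} => A \in [set A : {set 'I_n} | #|A| == m]%SET)).
  by rewrite sumr_const card_draws card_ord mule_natl.
by move=> A; rewrite inE.
Qed.

Lemma En_conn_subgraphs n m :
  En (fun g : graph n => (conn_subgraphs m (adj g))%:R) =
  'C(n, m)%:R%:E * cprob m.
Proof.
transitivity (En (fun g : graph n =>
    \sum_(A : {set 'I_n} | #|A| == m) (induced_connected (adj g) A)%:R)%R).
  by congr (En _); apply/funext => g; rewrite conn_subgraphsE natr_sum.
rewrite (En_sum _ hphi) //.
rewrite -sum_card_const; apply: eq_bigr => A /eqP.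
exact: En_induced_connected.
Qed.

Lemma expectation_conn_subgraphs m :
  \int[P]_w (conn_subgraphs m (adj (G w)))%:R%:E =
  (s ^+ m / m`!%:R)%:E * cprob m.
Proof.
rewrite (expectation_graph hG hphi s_gt0
  (F := fun n g => (conn_subgraphs m (adj g))%:R)); last first.
  by move=> n g; rewrite ler0n.
under eq_eseriesr do rewrite En_conn_subgraphs.
rewrite (poisson_series_shift m (a := fun=> cprob m)) //; last first.
  by move=> _; exact: conn_prob_ge0.
congr (_ * _); transitivity (\sum_(n <oo) cprob m * (poisson_pmf s n)%:E).
  by apply: eq_eseriesr => n _; rewrite muleC.
have cfin := conn_prob_fin_num X hphi m.
rewrite -(fineK cfin) nneseriesZl; last first.
  by move=> n _; rewrite lee_fin poisson_pmf_ge0.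
(* That the Poisson weights sum to 1 is the same expansion, applied to the constant 1. *)
have := expectation_graph hG hphi s_gt0 (F := fun _ _ => 1%R) (fun _ _ => ler01).
under eq_eseriesr do rewrite En1 // mule1.
move=> <-; rewrite -[RHS]mule1 fineK //; congr (_ * _).
by rewrite integral_cst // mul1e; exact: probability_setT.
Qed.

(** For each [A] the two factors read disjoint vertex sets, hence are independent, and the
    complement carries a graph of the same kind on [n - k] points. *)
Lemma En_mecke k n (f : nat -> R) : (forall i, 0 <= f i)%R ->
  En (fun g : graph n => \sum_(A : {set 'I_n} | #|A| == k)
    (induced_connected (adj g) A)%:R * f (count_avoiding (adj g) k A).+1)%R =
  'C(n, k)%:R%:E * (cprob k *
    En (fun g : graph (n - k) => f (conn_subgraphs k (adj g)).+1)).
Proof.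
move=> f0; rewrite (En_sum _ hphi) //; last by move=> A g; rewrite mulr_ge0.
rewrite -sum_card_const; apply: eq_bigr => A /eqP cA.
have [c [cI cAE]] := increasing_enum cA.
have [c' [cI' cAE']] : exists c' : 'I_(n - k) -> 'I_n,
    increasing c' /\ (c' @: finset.setT = ~: A)%SET.
  by apply: increasing_enum; rewrite cardsCs finset.setCK card_ord cA.
rewrite -(En_pull2 hG hphi cI cI').
- congr (En _); apply/funext => g.
  by rewrite induced_connected_pull // cAE (count_avoiding_pull _ _ cI' cAE').
- move=> i j; apply/eqP => cij.
  have : c' j \in (~: A)%SET by rewrite -cAE' imset_f.
  by rewrite inE -cij -cAE imset_f.
- by move=> g; rewrite ler0n.
- by move=> g; exact: f0.
Qed.

Definition removal_sum k (f : nat -> R) n (g : graph n) : R :=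
  \sum_(A : {set 'I_n} | #|A| == k)
    (induced_connected (adj g) A)%:R * f (count_avoiding (adj g) k A).+1.

(* The exact Palm (Mecke) identity: deleting the points of a connected k-set
   from a Poisson process leaves a Poisson process. *)
Lemma mecke k (f : nat -> R) : (forall i, 0 <= f i)%R ->
  \int[P]_w (removal_sum k f (G w))%:E =
  (s ^+ k / k`!%:R)%:E * cprob k *
    \int[P]_w (f (rcm_H N E k w).+1)%:E.
Proof.
move=> f0; have c0 := conn_prob_ge0 X hphi.
under [in RHS]eq_integral do rewrite (rcm_HE hG).
rewrite (expectation_graph hG hphi s_gt0
  (F := fun n g => f (conn_subgraphs k (adj g)).+1)) //.
rewrite (expectation_graph hG hphi s_gt0 (F := fun n g => removal_sum k f g)); last first.
  by move=> n g; apply: sumr_ge0 => A _; rewrite mulr_ge0 // ler0n.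
under eq_eseriesr do rewrite En_mecke //.
pose a n := cprob k * En (fun g : graph n => f (conn_subgraphs k (adj g)).+1).
rewrite (poisson_series_shift k (a := a)) //; last first.
  by move=> n; rewrite /a mule_ge0 ?En_ge0.
rewrite -muleA; congr (_ * _).
have cfin := conn_prob_fin_num X hphi k.
rewrite -(fineK cfin) -nneseriesZl; last first.
  by move=> n _; rewrite mule_ge0 ?En_ge0 // lee_fin poisson_pmf_ge0.
by apply: eq_eseriesr => n _; rewrite /a fineK // muleCA.
Qed.

Definition pair_bound k : \bar R := \sum_(k.+1 <= m < (2 * k).+1)
  (4 ^ m)%:R%:E * ((s ^+ m / m`!%:R)%:E * cprob m).

Lemma expectation_overlapping_pairs k :
  \int[P]_w (overlapping_pairs (adj (G w)) k)%:R%:E <= pair_bound k.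
Proof.
have mW (F : forall n, graph n -> R) :
    measurable_fun setT (fun w => (F (N w) (G w))%:E).
  by apply/measurable_EFinP; exact: measurable_graph_fun.
apply: (@le_trans _ _ (\int[P]_w \sum_(k.+1 <= m < (2 * k).+1)
    (4 ^ m)%:R%:E * (conn_subgraphs m (adj (G w)))%:R%:E)).
  apply: ge0_le_integral => //.
  - exact: (mW (fun n g => (overlapping_pairs (adj g) k)%:R)).
  - apply: emeasurable_sum => m; apply: emeasurable_funM => //.
    exact: (mW (fun n g => (conn_subgraphs m (adj g))%:R)).
  - move=> w _; under eq_bigr do rewrite -EFinM -natrM.
    by rewrite sumEFin -natr_sum lee_fin ler_nat overlapping_pairs_le.
rewrite ge0_integral_sum //; first last.
- move=> m; apply: emeasurable_funM => //.
  exact: (mW (fun n g => (conn_subgraphs m (adj g))%:R)).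
apply: lee_sum => m _; rewrite ge0_integralZl_EFin ?ler0n //; last first.
  exact: (mW (fun n g => (conn_subgraphs m (adj g))%:R)).
by rewrite expectation_conn_subgraphs.
Qed.

(** Two inequalities in place of an absolute value: the mean of H f(H) is not yet known to be
    finite, and a difference of infinite terms would carry no information. *)
Lemma stein_bound k (f : nat -> R) (L : R) : (0 < k)%N ->
  (forall i, 0 <= f i)%R -> (forall i, `|f i.+1 - f i| <= L)%R ->
  let H w := rcm_H N E k w in
  (s ^+ k / k`!%:R)%:E * cprob k * \int[P]_w (f (H w).+1)%:E <=
    \int[P]_w ((H w)%:R * f (H w))%:E + L%:E * pair_bound k /\
  \int[P]_w ((H w)%:R * f (H w))%:E <=
    (s ^+ k / k`!%:R)%:E * cprob k * \int[P]_w (f (H w).+1)%:E +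
      L%:E * pair_bound k.
Proof.
move=> k0 f0 fL H; rewrite -mecke //.
have L0 : (0 <= L)%R by apply: le_trans (fL 0%N); exact: normr_ge0.
have mW (F : forall n, graph n -> R) :
    measurable_fun setT (fun w => (F (N w) (G w))%:E).
  by apply/measurable_EFinP; exact: measurable_graph_fun.
have HE w : H w = conn_subgraphs k (adj (G w)) by rewrite /H (rcm_HE hG).
have mS : measurable_fun setT (fun w => (removal_sum k f (G w))%:E).
  exact: (mW (fun n g => removal_sum k f g)).
have mHf : measurable_fun setT (fun w => ((H w)%:R * f (H w))%:E).
  under eq_fun do rewrite HE.
  exact: (mW (fun n g => (conn_subgraphs k (adj g))%:R * f (conn_subgraphs k (adj g)))%R).
have mO : measurable_fun setT
    (fun w => (overlapping_pairs (adj (G w)) k)%:R%:E : \bar R).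
  exact: (mW (fun n g => (overlapping_pairs (adj g) k)%:R)).
have S0 w : (0 <= removal_sum k f (G w))%R.
  by apply: sumr_ge0 => A _; rewrite mulr_ge0 // ler0n.
have Hf0 w : (0 <= (H w)%:R * f (H w))%R by rewrite mulr_ge0.
have ptw w : (`|removal_sum k f (G w) - (H w)%:R * f (H w)| <=
    L * (overlapping_pairs (adj (G w)) k)%:R)%R.
  by rewrite HE; exact: stein_pointwise.
have add_int (Z : Omega -> \bar R) : measurable_fun setT Z ->
    (forall w, 0 <= Z w) ->
    \int[P]_w (Z w + L%:E * (overlapping_pairs (adj (G w)) k)%:R%:E) <=
    \int[P]_w Z w + L%:E * pair_bound k.
  move=> mZ Z0; rewrite ge0_integralD //; first last.
  - by apply: emeasurable_funM.
  - by move=> w _; rewrite mule_ge0 ?lee_fin.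
  rewrite leeD2l // ge0_integralZl_EFin //.
  by apply: lee_wpmul2l; rewrite ?lee_fin // expectation_overlapping_pairs.
split.
  apply: le_trans (add_int _ mHf _); last by move=> w; rewrite lee_fin.
  apply: ge0_le_integral => //.
  - by move=> w _; rewrite lee_fin.
  - by apply: emeasurable_funD => //; apply: emeasurable_funM.
  move=> w _; rewrite -EFinM -EFinD lee_fin -lerBlDl.
  exact: le_trans (ler_norm _) (ptw w).
apply: le_trans (add_int _ mS _); last by move=> w; rewrite lee_fin.
apply: ge0_le_integral => //.
- by move=> w _; rewrite lee_fin.
- by apply: emeasurable_funD => //; apply: emeasurable_funM.
move=> w _; rewrite -EFinM -EFinD lee_fin -lerBlDl.
by apply: le_trans (ptw w); rewrite distrC ler_norm.
Qed.

End stein_bound.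

(** * Real-valued bounds in terms of the maximal mean degree *)

Section real_stein_bound.
Context {d : measure_display} {T : measurableType d} {R : realType}.
Context (mu : probability T R).
Context {dO : measure_display} {Omega : measurableType dO}.
Context (P : probability Omega R) (s eps : R) (phi : T * T -> R).
Context (N : {RV P >-> nat}) (X : nat -> {RV P >-> T}).
Context (E : nat -> nat -> {RV P >-> bool}).
Hypothesis hG : random_connection_model mu s phi N X E.
Hypothesis heps : 0 < eps.
Hypothesis hphi : Phi_ mu eps phi.
Hypothesis s_gt0 : 0 < s.
Let hcf : connection_function phi := hphi.1.

Definition max_mean_degree : R :=
  s * fine (ereal_sup (range (mean_connection mu phi))).

Let M : R := fine (ereal_sup (range (mean_connection mu phi))).
Let q m : R := fine (conn_prob phi X m).

Let ME : ereal_sup (range (mean_connection mu phi)) = M%:E.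
Proof.
have /andP[M0 M1] := sup_mean_connection_bound mu hcf.
by rewrite /M fineK // ge0_fin_numE // (le_lt_trans M1) // ltry.
Qed.

Let M_ge0 : 0 <= M.
Proof. by have /andP[M0 _] := sup_mean_connection_bound mu hcf; rewrite fine_ge0. Qed.

Let qE m : conn_prob phi X m = (q m)%:E.
Proof. by rewrite /q fineK // conn_prob_fin_num. Qed.

Let q_ge0 m : 0 <= q m.
Proof. by rewrite fine_ge0 // conn_prob_ge0. Qed.

Lemma max_mean_degree_ge0 : 0 <= max_mean_degree.
Proof. by rewrite mulr_ge0 // ltW. Qed.

Let q_ub k i : (0 < k)%N -> (i <= k)%N ->
  q (k + i) <= ((4 * k ^ 2)%:R * M) ^+ i * q k.
Proof.
move=> k0; elim: i => [|i IH] ik; first by rewrite addn0 expr0 mul1r.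
have ki0 : (0 < k + i)%N by rewrite addn_gt0 k0.
have := conn_probS_le hG hcf ki0.
rewrite -addnS ME !qE -!EFinM lee_fin => /le_trans; apply.
rewrite exprS -!mulrA ler_pM //.
- by rewrite mulr_ge0.
(* Here k + i + 1 <= 2k, so the factor (k + i + 1)(k + i) is at most 4 k^2. *)
- rewrite ler_nat (@leq_trans ((2 * k) * (2 * k))) //.
    by rewrite leq_mul // mul2n -addnn ?leq_add2l // ltnW.
  by rewrite mulnACA mulnn.
by rewrite mulrC ler_wpM2l // IH // ltnW.
Qed.

Let q_lb m : (eps * M) ^+ m <= q m.+1.
Proof.
elim: m => [|m IH].
  by rewrite expr0 -lee_fin -qE (conn_prob1 phi X).
have := conn_probS_ge hG hcf (ltn0Sn m).
have : ((q m.+1)%:E * (eps%:E * M%:E) <=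
   conn_prob phi X m.+1 * ereal_inf (range (mean_connection mu phi)))%E.
  rewrite qE; apply: lee_wpmul2l; first by rewrite lee_fin.
  by rewrite -ME; exact: hphi.2.
move=> /le_trans/[apply]; rewrite qE -!EFinM lee_fin; apply: le_trans.
by rewrite exprSr ler_wpM2r // mulr_ge0 // ltW.
Qed.

Definition mean_count k : R := s ^+ k / k`!%:R * q k.

Let fact0 m : 0 < m`!%:R :> R. Proof. by rewrite ltr0n fact_gt0. Qed.

Lemma expectation_rcm_H k : ('E_P[fun w => (rcm_H N E k w)%:R] = (mean_count k)%:E)%E.
Proof.
rewrite unlock; under eq_integral do rewrite (rcm_HE hG).
by rewrite (expectation_conn_subgraphs hG hcf s_gt0) qE -EFinM.
Qed.

Lemma mean_count_ge0 k : 0 <= mean_count k.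
Proof. by rewrite mulr_ge0 // divr_ge0 ?exprn_ge0 // ltW. Qed.

(** Each attachment of a vertex has probability at least eps x / s, and k - 1 of them build a
    connected graph from one point. This bound makes x vanish when the mean is o(s). *)
Lemma mean_count_lb k : (0 < k)%N ->
  s * (eps * max_mean_degree) ^+ k.-1 / k`!%:R <= mean_count k.
Proof.
case: k => // k _ /=; rewrite /max_mean_degree -/M mulrCA exprMn /mean_count.
rewrite exprS -!mulrA; apply: ler_wpM2l; first exact: ltW.
apply: ler_wpM2l; first by rewrite exprn_ge0 // ltW.
by rewrite mulrC ler_wpM2l ?q_lb // invr_ge0 ltW.
Qed.

(** There are k orders m from k + 1 to 2k, each with at most 4^(2k) decompositions, and the first
    vertex beyond k costs a factor 4 k^2 x. *)
Definition stein_const k : R := (k * 4 ^ (2 * k) * (4 * k ^ 2))%:R.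

Lemma pair_bound_le k : (0 < k)%N -> stein_const k * max_mean_degree <= 1 ->
  (pair_bound s phi X k <=
   (mean_count k * (stein_const k * max_mean_degree))%:E)%E.
Proof.
move=> k0 small; set x := max_mean_degree in small *.
have x0 : 0 <= x := max_mean_degree_ge0.
pose y := (4 * k ^ 2)%:R * x.
have y0 : 0 <= y by rewrite mulr_ge0.
(* Vertices beyond the first extra one may then be ignored: y^(i+1) <= y. *)
have y1 : y <= 1.
  apply: le_trans small; rewrite /y /stein_const ler_wpM2r // ler_nat.
  by rewrite leq_pmull // muln_gt0 k0 expn_gt0.
rewrite /pair_bound -/(index_iota _ _).
apply: (@le_trans _ _ (\sum_(k.+1 <= m < (2 * k).+1)
   ((4 ^ (2 * k))%:R * (mean_count k * y))%:E)%E); last first.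
  rewrite sumEFin lee_fin sumr_const_nat subSS /stein_const mul2n -addnn addnK.
  rewrite -mulr_natl /y !natrM.
  by rewrite le_eqVlt; apply/orP; left; apply/eqP; ring.
rewrite big_seq [leRHS]big_seq; apply: lee_sum => m.
rewrite mem_index_iota ltnS => /andP[km m2k].
have [i mE] : exists i, m = (k + i.+1)%N.
  by exists (m - k).-1; rewrite prednK ?subn_gt0 // subnKC // ltnW.
have ik : (i < k)%N by move: m2k; rewrite mE mul2n -addnn leq_add2l.
rewrite qE -!EFinM lee_fin ler_pM //.
- by rewrite mulr_ge0 // divr_ge0 ?exprn_ge0 ?ltW.
- by rewrite ler_nat leq_exp2l.
apply: (@le_trans _ _ (s ^+ m / k`!%:R * (((4 * k ^ 2)%:R * M) ^+ i.+1 * q k))).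
  apply: ler_pM => //.
  - by rewrite divr_ge0 ?exprn_ge0 ?ltW.
  - apply: ler_wpM2l; first by rewrite exprn_ge0 // ltW.
    by rewrite lef_pV2 ?posrE // ler_nat leq_fact // ltnW.
  - by rewrite mE q_ub.
rewrite mE exprD /mean_count.
have -> : s ^+ k * s ^+ i.+1 / k`!%:R * (((4 * k ^ 2)%:R * M) ^+ i.+1 * q k) =
    s ^+ k / k`!%:R * q k * y ^+ i.+1.
  have -> : y = s * ((4 * k ^ 2)%:R * M) by rewrite /y /x /max_mean_degree mulrCA.
  rewrite [in RHS]exprMn; move: (_ ^+ i.+1) (s ^+ i.+1) => u v; ring.
rewrite ler_wpM2l ?mean_count_ge0 //.
by rewrite exprS ler_piMr // exprn_ile1.
Qed.

(** The bound [C] makes the mean of f(H + 1) finite, the second half of [stein_bound] then makes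
    that of H f(H) finite, and the two halves combine into one absolute value. *)
Lemma real_stein_bound k (f : nat -> R) (C L : R) : (0 < k)%N ->
  (forall i, 0 <= f i <= C) -> (forall i, `|f i.+1 - f i| <= L) ->
  stein_const k * max_mean_degree <= 1 ->
  `|fine (\int[P]_w (mean_count k * f (rcm_H N E k w).+1 -
      (rcm_H N E k w)%:R * f (rcm_H N E k w))%:E)| <=
    L * (mean_count k * (stein_const k * max_mean_degree)).
Proof.
move=> k0 fC fL small; set H := rcm_H N E k.
pose b := mean_count k * (stein_const k * max_mean_degree); rewrite -/b.
have f0 i : 0 <= f i by case/andP: (fC i).
have L0 : 0 <= L by apply: le_trans (fL 0%N); exact: normr_ge0.
have mH (F : nat -> R) : measurable_fun setT (fun w => (F (H w))%:E).
  apply/measurable_EFinP.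
  rewrite (_ : (fun w => F (H w)) =
    (fun w => F (conn_subgraphs k (adj (random_graph N E w))))).
    exact: (measurable_graph_fun N E (fun n g => F (conn_subgraphs k (adj g)))).
  by apply/funext => w; rewrite /H (rcm_HE hG).
have := stein_bound hG hcf s_gt0 k0 f0 fL.
rewrite /= qE -EFinM -/(mean_count k).
have fin_a : (\int[P]_w (f (H w).+1)%:E)%E \is a fin_num.
  rewrite ge0_fin_numE; last by apply: integral_ge0 => w _; rewrite lee_fin.
  apply: (@le_lt_trans _ _ (\int[P]_w C%:E)%E).
    apply: ge0_le_integral => //; first by move=> w _; rewrite lee_fin.
      exact: (mH (fun i => f i.+1)).
    by move=> w _; rewrite lee_fin; case/andP: (fC (H w).+1).
  rewrite (_ : \int[P]_w _ = C%:E)%E ?ltry // integral_cst // -[RHS]mule1.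
  by congr (_ * _)%E; exact: probability_setT.
set a := (\int[P]_w (f (H w).+1)%:E)%E in fin_a *.
set h := (\int[P]_w ((H w)%:R * f (H w))%:E)%E.
have pbL : (L%:E * pair_bound s phi X k <= (L * b)%:E)%E.
  by rewrite EFinM lee_wpmul2l ?lee_fin // pair_bound_le.
move=> [/le_trans lo /le_trans hi].
have {}lo := lo _ (leeD2l h pbL); have {}hi := hi _ (leeD2l _ pbL).
have h0 : (0 <= h)%E by apply: integral_ge0 => w _; rewrite lee_fin mulr_ge0.
have fin_h : h \is a fin_num.
  by rewrite ge0_fin_numE // (le_lt_trans hi) // -(fineK fin_a) -EFinM -EFinD ltry.
have integr (F : nat -> R) : (forall i, 0 <= F i) ->
    (\int[P]_w (F (H w))%:E)%E \is a fin_num ->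
    P.-integrable setT (fun w => (F (H w))%:E).
  move=> F0 Ffin; apply/integrableP; split; first exact: mH.
  have absE w : `|(F (H w))%:E|%E = (F (H w))%:E by rewrite gee0_abs ?lee_fin.
  under eq_integral do rewrite absE.
  by rewrite -ge0_fin_numE // integral_ge0 // => w _; rewrite lee_fin.
have aE : (\int[P]_w (mean_count k * f (H w).+1)%:E = (mean_count k)%:E * a)%E.
  under eq_integral do rewrite EFinM.
  apply: ge0_integralZl_EFin => //; last exact: mean_count_ge0.
    by move=> w _; rewrite lee_fin.
  exact: (mH (fun i => f i.+1)).
have -> : (\int[P]_w (mean_count k * f (H w).+1 - (H w)%:R * f (H w))%:E =
    (mean_count k)%:E * a - h)%E.
  under eq_integral do rewrite EFinB.
  rewrite integralB //; first by rewrite aE.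
    apply: (integr (fun i => mean_count k * f i.+1)).
      by move=> i; rewrite mulr_ge0 // mean_count_ge0.
    by rewrite aE -(fineK fin_a).
  by apply: (integr (fun i => i%:R * f i)) => // i; rewrite mulr_ge0.
rewrite -(fineK fin_a) -(fineK fin_h) -EFinM -EFinB /=.
move: lo hi; rewrite -(fineK fin_a) -(fineK fin_h) -!EFinM -!EFinD !lee_fin.
by move=> lo hi; rewrite ler_norml; apply/andP; split; lra.
Qed.

End real_stein_bound.

Lemma cvg0_le_norm {T : Type} {F : set_system T} {FF : Filter F} {R : realType}
    (f g : T -> R) :
  (\forall s \near F, `|f s| <= g s) -> g s @[s --> F] --> (0 : R) ->
  f s @[s --> F] --> (0 : R).
Proof.
move=> fg /cvgr0Pnorm_le g0; apply/cvgr0Pnorm_le => e e0.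
near=> s; apply: (@le_trans _ _ `|g s|); last by near: s; exact: g0.
by apply: (@le_trans _ _ (g s)); [near: s|exact: ler_norm].
Unshelve. all: by end_near. Qed.

(** * Point probabilities of integer-valued variables *)

Section counting_variables.
Context {R : realType} {dO : measure_display} {Omega : measurableType dO}.
Context (P : probability Omega R) (H : Omega -> nat).
Hypothesis mH : forall A : set nat, measurable (H @^-1` A).

Lemma prob_lt_sum n :
  P (H @^-1` `I_n) = (\sum_(j < n) P (H @^-1` [set j : nat]))%E.
Proof.
elim: n => [|n IH]; first by rewrite II0 preimage_set0 measure0 big_ord0.
rewrite big_ord_recr /= -IH -measureU //.
  by congr (P _); rewrite -preimage_setU; congr (_ @^-1` _); rewrite IIS.
by apply/seteqP; split => // w [/= + Hn]; rewrite Hn ltnn.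
Qed.

Definition pmass j : R := fine (P (H @^-1` [set j])).

Lemma pmassE j : P (H @^-1` [set j]) = (pmass j)%:E.
Proof. by rewrite fineK // fin_num_measure. Qed.

Lemma pmass_ge0 j : 0 <= pmass j.
Proof. by rewrite fine_ge0. Qed.

Lemma pmass_le1 j : pmass j <= 1.
Proof. by rewrite -lee_fin -pmassE probability_le1. Qed.

Lemma prob_ltE n : P (H @^-1` `I_n) = (\sum_(j < n) pmass j)%:E.
Proof. by rewrite prob_lt_sum -sumEFin; apply: eq_bigr => j _; rewrite pmassE. Qed.

Lemma measurable_count_fun (F : nat -> R) :
  measurable_fun setT (fun w => F (H w)).
Proof. by move=> _ Y mY; rewrite setTI; exact: (mH (F @^-1` Y)). Qed.

Lemma markov_count (a : R) n : ('E_P[fun w => (H w)%:R] = a%:E)%E -> (0 < n)%N ->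
  1 - \sum_(j < n) pmass j <= a / n%:R.
Proof.
rewrite unlock => Ea n0; rewrite ler_pdivlMr ?ltr0n // -lee_fin -Ea.
rewrite EFinM EFinB -prob_ltE -probability_setC //.
have mC : measurable (~` (H @^-1` `I_n)) by exact: measurableC.
rewrite muleC -[X in (_ * X <= _)%E]mul1e -(setIT (~` _)) -integral_indic //.
rewrite mul1e -ge0_integralZl_EFin //; first last.
- exact/measurable_EFinP/measurable_indic.
apply: ge0_le_integral => //.
- apply: emeasurable_funM => //; exact/measurable_EFinP/measurable_indic.
- exact/measurable_EFinP/(measurable_count_fun (fun i => i%:R)).
move=> w _; rewrite -EFinM lee_fin indicE; case: (boolP (_ \in _)) => [|_].
  by rewrite inE /= mulr1 ler_nat => /negP; rewrite -leqNgt.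
by rewrite mulr0.
Qed.

Lemma integral_pmass (a : R) j : 0 <= a ->
  (\int[P]_w (a * (H w == j)%:R)%:E = (a * pmass j)%:E)%E.
Proof.
move=> a0; rewrite EFinM -pmassE -(setIT (H @^-1` _)) -integral_indic //.
rewrite -(@integralZl_indic _ _ _ P setT measurableT (fun=> H @^-1` [set j])) //; last first.
  by move=> /lt_geF; rewrite a0.
apply: eq_integral => w _; rewrite indicE; congr (a * (nat_of_bool _)%:R)%:E.
by apply/idP/idP => [/eqP <-|]; rewrite inE //= => ->.
Qed.

Lemma integral_pmass_diff (a : R) j : 0 <= a ->
  fine (\int[P]_w (a * ((H w).+1 == j.+1)%:R - (H w)%:R * (H w == j.+1)%:R)%:E) =
  a * pmass j - j.+1%:R * pmass j.+1.
Proof.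
move=> a0; rewrite -[RHS]/(fine (_ - _)%:E) EFinB -!integral_pmass //.
rewrite -integralB_EFin //.
- congr fine; apply: eq_integral => w _; rewrite -EFinB eqSS.
  by case: (H w =P j.+1) => [->//|_]; rewrite !mulr0.
- apply: measurable_bounded_integrable => //.
  + by rewrite (le_lt_trans (probability_le1 _ _)) // ltry.
  + exact: (measurable_count_fun (fun i => a * (i == j)%:R)).
  + exists a; split; rewrite ?num_real // => y ay w _ /=.
    rewrite (le_trans _ (ltW ay)) // normrM normr_nat ger0_norm //.
    by case: (H w == j); rewrite ?mulr1 ?mulr0.
- apply: measurable_bounded_integrable => //.
  + by rewrite (le_lt_trans (probability_le1 _ _)) // ltry.
  + exact: (measurable_count_fun (fun i => j.+1%:R * (i == j.+1)%:R)).
  + exists j.+1%:R; split; rewrite ?num_real // => y ay w _ /=.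
    rewrite (le_trans _ (ltW ay)) // normrM normr_nat ger0_norm //.
    by case: (H w == j.+1); rewrite ?mulr1 ?mulr0.
Qed.

Lemma integrable_count (F : nat -> R) C : (forall i, `|F i| <= C) ->
  P.-integrable setT (EFin \o (fun w => F (H w))).
Proof.
move=> FC; apply: measurable_bounded_integrable => //.
- by rewrite (le_lt_trans (probability_le1 _ _)) // ltry.
- exact: measurable_count_fun.
- exists C; split; rewrite ?num_real // => y Cy w _ /=.
  exact: le_trans (FC _) (ltW Cy).
Qed.

Lemma Rintegral_cst_prob (c : R) : \int[P]_w c = c.
Proof.
rewrite Rintegral_cst // (_ : fine _ = 1) ?mulr1 //.
by rewrite (_ : 1 = fine 1%:E) //; congr fine; exact: probability_setT.
Qed.

Lemma norm_Rintegral_count (F : nat -> R) C : (forall i, `|F i| <= C) ->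
  `|\int[P]_w F (H w)| <= C.
Proof.
move=> FC; apply: le_trans (le_normr_Rintegral measurableT (integrable_count FC)) _.
rewrite -[leRHS]Rintegral_cst_prob; apply: le_Rintegral => //.
- by apply: (@integrable_count (fun i => `|F i|) C) => i; rewrite normr_id.
- by apply: (@integrable_count (fun=> C) `|C|).
Qed.

Lemma Rintegral_count_lt n :
  \int[P]_w (H w < n)%:R = fine (P (H @^-1` `I_n)).
Proof.
rewrite /Rintegral -(setIT (H @^-1` _)) -integral_indic //; congr fine.
apply: eq_integral => w _; rewrite indicE; congr (nat_of_bool _)%:R%:E.
by apply/idP/idP => [Hn|]; rewrite inE.
Qed.

End counting_variables.

(** * The normal Stein equation *)

Section mills_function.
Context {R : realType}.
Notation mu := (@lebesgue_measure R).
Implicit Types x y h r : R.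

Definition mills_kernel x r : R := expR (x * r - r ^+ 2 / 2).
Local Notation k := mills_kernel.

Lemma is_derive_mills_kernel x r : is_derive r 1 (k x) ((x - r) * k x r).
Proof.
have dg : is_derive r 1 (fun r : R => x * r - r ^+ 2 / 2) (x - r).
  apply: is_derive_eq.
  rewrite !scaler0 add0r /GRing.scale /= !mulr1.
  by field.
rewrite mulrC; exact: (@is_derive1_comp _ expR _ _ _ _ (is_derive_expR _) dg).
Qed.

Lemma continuous_mills_kernel x : continuous (k x).
Proof.
move=> r; apply: differentiable_continuous; apply/derivable1_diffP.
exact: (@ex_derive _ _ _ _ _ _ _ (is_derive_mills_kernel x r)).
Qed.

Lemma mills_kernel_cvg0 x : k x r @[r --> +oo] --> (0 : R).
Proof.
apply: (@cvg0_le_norm _ _ _ _ _ (fun r => expR ((x + 1) ^+ 2 / 2) * expR (- r))).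
  near=> r; rewrite ger0_norm ?expR_ge0 // -expRD ler_expR -subr_ge0.
  rewrite (_ : _ - _ = (r - (x + 1)) ^+ 2 / 2); last by field.
  by rewrite divr_ge0 // sqr_ge0.
have := @cvgr_expR R; move=> e0.
have : expR ((x + 1) ^+ 2 / 2) * expR (- r) @[r --> +oo] -->
    expR ((x + 1) ^+ 2 / 2) * 0 by apply: cvgM; [exact: cvg_cst|exact: e0].
by rewrite mulr0.
Unshelve. all: by end_near. Qed.

(** Completing the square exhibits a normal density of mean [x], which settles integrability. *)
Lemma mills_kernelE x r :
  k x r = expR (x ^+ 2 / 2) / normal_peak 1 * normal_pdf x 1 r.
Proof.
rewrite normal_pdfE ?oner_eq0 // mulrA divfK ?gt_eqF ?normal_peak_gt0 ?oner_eq0 //.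
rewrite /normal_fun -expRD /k; congr expR; rewrite expr1n.
by rewrite -[1 *+ 2]/(2 : R); field.
Qed.

Lemma measurable_mills_kernel x D : measurable_fun D (k x).
Proof.
by apply: measurable_funTS; apply: continuous_measurable_fun;
  exact: continuous_mills_kernel.
Qed.

Lemma integrable_mills_kernel x : mu.-integrable `[0, +oo[ (EFin \o k x).
Proof.
have -> : EFin \o k x = (fun r => (expR (x ^+ 2 / 2) / normal_peak 1)%:E *
    (normal_pdf x 1 r)%:E)%E.
  by apply/funext => r /=; rewrite mills_kernelE EFinM.
apply: integrableZl => //.
by apply: (integrableS measurableT) => //; exact: integrable_normal_pdf.
Qed.

Lemma integrable_id_mills_kernel x :
  mu.-integrable `[0, +oo[ (EFin \o (fun r => r * k x r)).
Proof.
apply: le_integrable (integrable_mills_kernel (x + 1)) => //.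
  apply/measurable_EFinP/measurable_funM => //; exact: measurable_mills_kernel.
move=> r /=; rewrite in_itv /= andbT => r0.
rewrite lee_fin ger0_norm ?mulr_ge0 ?expR_ge0 // ger0_norm ?expR_ge0 //.
(* The bound r <= exp r trades the factor [r] for a shift of [x] by 1. *)
have -> : k (x + 1) r = expR r * k x r.
  by rewrite /k -expRD; congr expR; ring.
rewrite ler_wpM2r ?expR_ge0 //.
by rewrite (le_trans _ (expR_ge1Dx r)) // lerDr.
Qed.

(* Locked so that unification never unfolds the integral. *)
Definition mills x : R := locked (\int[mu]_(r in `[0, +oo[) k x r).

Lemma millsE x : mills x = \int[mu]_(r in `[0, +oo[) k x r.
Proof. by rewrite /mills -lock. Qed.

Lemma mills_ge0 x : 0 <= mills x.
Proof. by rewrite millsE; apply: Rintegral_ge0 => r _; exact: expR_ge0. Qed.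

Lemma integrable_mills_derive x :
  mu.-integrable `[0, +oo[ (EFin \o (fun r => (r - x) * k x r)).
Proof.
rewrite (_ : EFin \o _ = (fun r => (r * k x r)%:E - (x * k x r)%:E)%E); last first.
  by apply/funext => r /=; rewrite -EFinB mulrBl.
apply: integrableB => //; first exact: integrable_id_mills_kernel.
exact: integrableZl (integrable_mills_kernel x).
Qed.

(** The integrand is the derivative of minus the kernel, which rises from -1 at 0 to the limit 0 at
    infinity. *)
Lemma integral_mills_derive x : \int[mu]_(r in `[0, +oo[) ((r - x) * k x r) = 1.
Proof.
have intf := integrable_mills_derive x.
pose F r := - k x r.
have dF r : is_derive r 1 F ((r - x) * k x r).
  rewrite -opprB mulNr; exact: (is_deriveN (is_derive_mills_kernel x r)).
have F'E r : derive1 F r = (r - x) * k x r by rewrite derive1E; exact: derive_val.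
have cF : continuous F by move=> r; apply: cvgN; exact: continuous_mills_kernel.
have cf : continuous (fun r => (r - x) * k x r).
  move=> r; apply: cvgM; last exact: continuous_mills_kernel.
  by apply: cvgB; [exact: cvg_id|exact: cvg_cst].
have Fy : F r @[r --> +oo] --> (0 : R).
  by rewrite -oppr0; apply: cvgN; exact: mills_kernel_cvg0.
have tail a : x <= a -> \int[mu]_(r in `[a, +oo[) ((r - x) * k x r) = k x a.
  move=> xa; rewrite (Rintegral_ge0_continuous_FTC2y (F := F) (l := 0)) //.
  - by rewrite sub0r opprK.
  - by move=> r ar; rewrite mulr_ge0 ?expR_ge0 // subr_ge0 (le_trans xa).
  - exact: continuous_subspaceT.
  - by apply: cvg_at_right_filter; exact: cF.
have k0 : k x 0 = 1 by rewrite /k mulr0 expr0n /= mul0r subrr expR0.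
(* For x > 0 the integrand is negative before [x], while [tail] rests on a half-line theorem for
   nonnegative functions; so the integral is cut at [x]. *)
have [x0|x0] := leP x 0; first by rewrite tail.
have xx : (BLeft 0 <= BRight x)%O by rewrite bnd_simp ltW.
have := Rintegral_itvB intf xx isT => /eqP; rewrite subr_eq => /eqP ->.
rewrite Rintegral_itv_obnd_cbnd; last first.
  apply: integrableS intf => //.
  by apply: subset_itvr; rewrite bnd_simp ltW.
rewrite tail // /Rintegral (continuous_FTC2 (F := F)) //.
- by rewrite /= /F k0; ring.
- exact: continuous_subspaceT.
- by split => //; [apply: cvg_at_right_filter|apply: cvg_at_left_filter]; exact: cF.
Qed.

Lemma integral_id_mills x :
  \int[mu]_(r in `[0, +oo[) (r * k x r) = 1 + x * mills x.
Proof.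
rewrite -[in RHS](integral_mills_derive x) millsE -RintegralZl //; last first.
  exact: integrable_mills_kernel.
rewrite -RintegralD //.
- by apply: eq_Rintegral => r _; rewrite -mulrDl subrK.
- exact: integrable_mills_derive.
- exact: integrableZl (integrable_mills_kernel x).
Qed.

(** This is the derivative of [mills], and by [integral_id_mills] the integral of r times the
    kernel. The integral form gives sign and monotonicity, the closed form gives the Stein
    equation. *)
Definition mills_drift x : R := 1 + x * mills x.

Lemma mills_drift_ge0 x : 0 <= mills_drift x.
Proof.
rewrite /mills_drift -integral_id_mills; apply: Rintegral_ge0 => r /=.
by rewrite in_itv /= andbT => r0; rewrite mulr_ge0 ?expR_ge0.
Qed.

Lemma mills_kernel_increment x h r :
  k (x + h) r - k x r = (expR (h * r) - 1) * k x r.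
Proof. by rewrite /k mulrBl mul1r -expRD; congr (expR _ - _); ring. Qed.

(** The inequalities exp(hr) - 1 >= hr and 1 - exp(-hr) <= hr, integrated against the kernels at [x]
    and at [x + h]. They stand in for the derivative of [mills]. *)
Lemma mills_increment x h : 0 <= h ->
  h * mills_drift x <= mills (x + h) - mills x <= h * mills_drift (x + h).
Proof.
move=> h0; rewrite /mills_drift -!integral_id_mills !millsE.
have ik y := integrable_mills_kernel y.
have irk y := integrable_id_mills_kernel y.
have ikB y z : mu.-integrable `[0, +oo[ (EFin \o (fun r => k y r - k z r)).
  exact: (integrableB _ (ik y) (ik z)).
rewrite -RintegralB // -!RintegralZl //; apply/andP; split.
  apply: le_Rintegral => //.
    exact: integrableZl (irk x).
  move=> r; rewrite /= in_itv /= andbT => r0.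
  rewrite mills_kernel_increment mulrA ler_wpM2r ?expR_ge0 //.
  by rewrite lerBrDl expR_ge1Dx.
apply: le_Rintegral => //.
  exact: integrableZl (irk (x + h)).
move=> r; rewrite /= in_itv /= andbT => r0.
have -> : k x r = k (x + h) r * expR (- (h * r)).
  by rewrite /k -expRD; congr expR; ring.
rewrite -[X in X - _]mulr1 -mulrBr mulrA [leRHS]mulrC ler_wpM2l ?expR_ge0 //.
by rewrite lerBlDr -lerBlDl expR_ge1Dx.
Qed.

Lemma mills_increasing x y : x <= y -> mills x <= mills y.
Proof.
move=> xy; have y0 : 0 <= y - x by rewrite subr_ge0.
have /andP[+ _] := mills_increment x y0; rewrite -[mills x <= _]subr_ge0.
rewrite (_ : x + (y - x) = y); last by rewrite addrC subrK.
move=> h; apply: le_trans h.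
by rewrite mulr_ge0 // mills_drift_ge0.
Qed.

Lemma mills_drift_increasing x y : x <= y -> mills_drift x <= mills_drift y.
Proof.
move=> xy; rewrite /mills_drift -!integral_id_mills.
apply: le_Rintegral => //; [exact: integrable_id_mills_kernel..|].
move=> r; rewrite /= in_itv /= andbT => r0.
by rewrite ler_wpM2l // ler_expR lerD2r ler_wpM2r.
Qed.

Definition gauss_cst : R := locked (normal_peak 1).

Lemma gauss_cstE : gauss_cst = normal_peak 1.
Proof. by rewrite /gauss_cst -lock. Qed.

Lemma gauss_cst_ge0 : 0 <= gauss_cst.
Proof. by rewrite gauss_cstE normal_peak_ge0. Qed.

(** The substitution t = r + a splits the density into its value at [a] and the kernel at [- a]. *)
Lemma normal_tail a : \int[mu]_(t in `[a, +oo[) normal_pdf 0 1 t =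
  gauss_cst * expR (- (a ^+ 2 / 2)) * mills (- a).
Proof.
have -> : \int[mu]_(t in `[a, +oo[) normal_pdf 0 1 t =
    \int[mu]_(r in `[0, +oo[) normal_pdf 0 1 (r + a).
  pose F r := r + a.
  have F0 : F 0 = a by rewrite /F add0r.
  have dF r : is_derive r 1 F 1 by rewrite -[X in is_derive _ _ _ X]addr0; exact: is_deriveD.
  have F'E : derive1 F = cst 1.
    by apply/funext => r; rewrite derive1E; exact: derive_val.
  have cF : continuous F by move=> r; apply: cvgD; [exact: cvg_id|exact: cvg_cst].
  rewrite -{1}F0 /Rintegral increasing_ge0_integration_by_substitutiony //.
  - by congr fine; apply: eq_integral => r _; rewrite F'E /= mulr1.
  - by move=> r s _ _; rewrite ltrD2r.
  - by rewrite F'E => r _; exact: cvg_cst.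
  - by rewrite F'E; exact: is_cvg_cst.
  - by rewrite F'E; exact: is_cvg_cst.
  - by split; [move=> r _; exact: ex_derive|apply: cvg_at_right_filter; exact: cF].
  - exact: cvg_addrr.
  - by apply: continuous_subspaceT; apply: continuous_normal_pdf; rewrite oner_eq0.
  - by move=> r _; exact: normal_pdf_ge0.
rewrite millsE -RintegralZl //; last exact: integrable_mills_kernel.
apply: eq_Rintegral => r _.
rewrite gauss_cstE normal_pdfE ?oner_eq0 // -mulrA; congr (_ * _).
rewrite /normal_fun -expRD; congr expR; rewrite expr1n.
by rewrite -[1 *+ 2]/(2 : R); field.
Qed.

Definition Phi x : R := locked (fine (normal_prob 0 1 `]-oo, x]%classic)).

Lemma Phi_def x : Phi x = fine (normal_prob 0 1 `]-oo, x]%classic).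
Proof. by rewrite /Phi -lock. Qed.

Lemma normal_pdf_even t : normal_pdf 0 1 (- t) = normal_pdf 0 1 t :> R.
Proof. by rewrite !normal_pdfE ?oner_eq0 // /normal_fun !subr0 sqrrN. Qed.

Lemma PhiE x : Phi x = gauss_cst * expR (- (x ^+ 2 / 2)) * mills x.
Proof.
rewrite -[in mills x](opprK x) -[in x ^+ 2]sqrrN -normal_tail.
rewrite Phi_def /normal_prob /Rintegral; congr fine.
rewrite -{1}[x]opprK ge0_integration_by_substitutionNy.
- by apply: eq_integral => t _; rewrite /= normal_pdf_even.
- by apply: continuous_subspaceT; apply: continuous_normal_pdf; rewrite oner_eq0.
- by move=> r _; exact: normal_pdf_ge0.
Qed.

Lemma Phi_compl x : 1 - Phi x = gauss_cst * expR (- (x ^+ 2 / 2)) * mills (- x).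
Proof.
rewrite -normal_tail Phi_def.
have := @probability_setC _ _ R (normal_prob 0 1) `]-oo, x]%classic.
rewrite setCitvl => /(_ (measurable_itv _)) /(congr1 fine).
rewrite -[X in (1 - X)%E]fineK ?fin_num_measure // -EFinB /= => <-.
rewrite /Rintegral /normal_prob; congr fine.
apply: integral_itv_obnd_cbnd.
by apply/measurable_EFinP; apply: measurable_funTS; exact: measurable_normal_pdf.
Qed.

End mills_function.

(** * The Stein equation on a lattice, for abstract U and J = U' *)

Section stein_equation.
Context {R : realFieldType} (U J : R -> R).
Implicit Types x y b t : R.
Hypothesis U_ge0 : forall x, 0 <= U x.
Hypothesis U_mono : forall x y, x <= y -> U x <= U y.
Hypothesis J_ge0 : forall x, 0 <= J x.
Hypothesis J_mono : forall x y, x <= y -> J x <= J y.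
Hypothesis JE : forall x, J x = 1 + x * U x.
Hypothesis U_inc : forall x h, 0 <= h ->
  h * J x <= U (x + h) - U x <= h * J (x + h).

(** Bounds the slope of J on the half-line up to [b], since J = 1 + x U and U' = J give J' = U + x
    J. *)
Definition drift_slope b : R := U b + `|b| * J b.

Lemma drift_slope_ge0 b : 0 <= drift_slope b.
Proof. by rewrite addr_ge0 // mulr_ge0. Qed.

Lemma drift_increment y h b : 0 <= h -> y + h <= b ->
  0 <= J (y + h) - J y <= h * drift_slope b.
Proof.
move=> h0 yb; rewrite subr_ge0 J_mono ?lerDl //=.
have yhb := U_mono yb; have dyhb := J_mono yb.
have /andP[_ inc] := U_inc y h0.
have incb : U (y + h) - U y <= h * J b by rewrite (le_trans inc) // ler_wpM2l.
have inc0 : 0 <= U (y + h) - U y by rewrite subr_ge0 U_mono ?lerDl.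
have -> : J (y + h) - J y = h * U (y + h) + y * (U (y + h) - U y).
  by rewrite !JE; ring.
rewrite /drift_slope [leRHS]mulrDr lerD ?ler_wpM2l //.
(* For y <= 0 the second term has the favourable sign; otherwise y <= |b|. *)
have [y0|y0] := leP y 0.
  by apply: (@le_trans _ _ 0); rewrite ?mulr_le0_ge0 // !mulr_ge0.
rewrite mulrCA; apply: ler_pM => //; first exact: ltW.
by rewrite (le_trans _ (ler_norm b)) // (le_trans _ yb) // lerDl.
Qed.

Context (alpha h KL KR p : R) (z : nat -> R) (j1 : nat).
Local Notation a := (z j1).
Hypothesis h_gt0 : 0 < h.
Hypothesis halpha : h * alpha = h^-1.
Hypothesis zE : forall j, z j = (j%:R - alpha) * h.
Hypothesis KL_ge0 : 0 <= KL.
Hypothesis KR_ge0 : 0 <= KR.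
Hypothesis pL : 1 - p = KL.
Hypothesis pR : p = KR.
Hypothesis glue : KL * U a = KR * U (- a).

(** The bounded solution of F' - x F = 1(x < a) - p, sampled on the lattice. Since U' - x U = 1,
    multiples of U and of its reflection solve it on the two sides of a, and [glue] makes them agree
    at a. *)
Definition stein_f (j : nat) : R :=
  if (j < j1)%N then KL * U (z j) else KR * U (- z j).

Let h_ge0 : 0 <= h. Proof. exact: ltW. Qed.

Let zS j : z j.+1 = z j + h. Proof. by rewrite !zE -natr1; ring. Qed.

Let z_le j i : (j <= i)%N -> z j <= z i.
Proof. by move=> ji; rewrite !zE ler_wpM2r // lerD2r ler_nat. Qed.

Lemma stein_f_bound j : 0 <= stein_f j <= KL * U a.
Proof.
rewrite /stein_f; case: ltnP => jj1.
  by rewrite mulr_ge0 //= ler_wpM2l // U_mono // z_le // ltnW.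
by rewrite mulr_ge0 //= glue ler_wpM2l // U_mono // lerN2 z_le.
Qed.

Let stein_fL j : (j < j1)%N ->
  stein_f j.+1 - stein_f j = KL * (U (z j + h) - U (z j)).
Proof.
move=> jj1; rewrite {2}/stein_f jj1 -zS mulrBr; congr (_ - _).
rewrite /stein_f; case: ltnP => // j1j.
(* The last step to the left of a ends on the right-hand branch, which equals the left-hand one
   there. *)
have -> : j.+1 = j1 by apply/eqP; rewrite eqn_leq jj1.
by rewrite -glue.
Qed.

Let stein_fR j y : (j1 <= j)%N -> z j = - (y + h) ->
  stein_f j.+1 - stein_f j = - (KR * (U (y + h) - U y)).
Proof.
move=> jj1 zy; rewrite /stein_f !ltnNge jj1 leqW //= zS zy.
by rewrite opprD opprK addrK; ring.
Qed.

(** Reflection turns a step on the right of a into a step from y to y + h below -a, so the same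
    estimates serve both sides. *)
Let rightP j : (j1 <= j)%N -> exists y, z j = - (y + h) /\ y + h <= - a.
Proof.
move=> jj1; exists (- z j - h); rewrite subrK opprK; split=> //.
by rewrite lerN2 z_le.
Qed.

Definition stein_lip : R := h * (KL * J a + KR * J (- a)).

Lemma stein_f_lip j : `|stein_f j.+1 - stein_f j| <= stein_lip.
Proof.
rewrite /stein_lip [leRHS]mulrDr; case: (ltnP j j1) => jj1.
  have za : z j + h <= a by rewrite -zS z_le.
  have /andP[_ inc] := U_inc (z j) h_ge0.
  have inc0 : 0 <= U (z j + h) - U (z j) by rewrite subr_ge0 U_mono ?lerDl.
  rewrite stein_fL // ger0_norm ?mulr_ge0 //.
  apply: (@le_trans _ _ (h * (KL * J a))); last by rewrite lerDl !mulr_ge0.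
  rewrite mulrCA ler_wpM2l // (le_trans inc) // ler_wpM2l //.
  exact: J_mono.
have [y [zy ya]] := rightP jj1.
have /andP[_ inc] := U_inc y h_ge0.
have inc0 : 0 <= U (y + h) - U y by rewrite subr_ge0 U_mono ?lerDl.
rewrite (stein_fR jj1 zy) normrN ger0_norm ?mulr_ge0 //.
apply: (@le_trans _ _ (h * (KR * J (- a)))); last by rewrite lerDr !mulr_ge0.
rewrite mulrCA ler_wpM2l // (le_trans inc) // ler_wpM2l //.
exact: J_mono.
Qed.

Definition stein_err : R := h * (KL * drift_slope a + KR * drift_slope (- a)).

(* On the lattice [z] the point [a] is the first one above the threshold, so a
   step of length [h] never crosses it. *)
Lemma stein_equation j :
  `|(j < j1)%:R - p - h * (alpha * stein_f j.+1 - j%:R * stein_f j)|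
    <= stein_err.
Proof.
(* With h alpha = 1 / h and h j = z_j + 1 / h, the Poisson-type operator becomes a difference
   quotient minus z_j f(j), the discrete F' - x F. *)
have -> : h * (alpha * stein_f j.+1 - j%:R * stein_f j) =
    h^-1 * (stein_f j.+1 - stein_f j) - z j * stein_f j.
  by rewrite -halpha zE; ring.
have hV : h * h^-1 = 1 by rewrite mulfV // gt_eqF.
(* The difference quotient of U lies between the values of J at the ends of the step; replacing it
   by one of them costs an increment of J, which is O(h). *)
have quot x I : h * J x <= I <= h * J (x + h) -> J x <= h^-1 * I <= J (x + h).
  by rewrite -!(ler_pM2l h_gt0 _ (_ * I)) -!(ler_pM2l h_gt0 (_ * I)) mulrA hV mul1r.
have S0 b K : 0 <= K -> 0 <= h * (K * drift_slope b).
  by move=> K0; rewrite !mulr_ge0 // drift_slope_ge0.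
rewrite /stein_err [leRHS]mulrDr; case: (ltnP j j1) => jj1.
  have za : z j + h <= a by rewrite -zS z_le.
  have := quot _ _ (U_inc (z j) h_ge0).
  rewrite (stein_fL jj1) {1}/stein_f jj1; move: (U _ - U _) => I /andP[lo hi].
  have /andP[_ dr] := drift_increment h_ge0 za.
  have -> : true%:R - p - (h^-1 * (KL * I) - z j * (KL * U (z j))) =
     - (KL * (h^-1 * I - J (z j))).
    by rewrite JE; rewrite -[true%:R]/(1 : R) pL; ring.
  have e0 : 0 <= h^-1 * I - J (z j) by rewrite subr_ge0.
  rewrite normrN ger0_norm ?mulr_ge0 //.
  apply: (@le_trans _ _ (h * (KL * drift_slope a))); last by rewrite lerDl S0.
  by rewrite mulrCA ler_wpM2l // (le_trans _ dr) // lerD2r.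
have [y [zy ya]] := rightP jj1.
have := quot _ _ (U_inc y h_ge0).
rewrite (stein_fR jj1 zy) {1}/stein_f ltnNge jj1 /= zy opprK.
have /andP[_ dr] := drift_increment h_ge0 ya.
set I := U _ - U _ => /andP[lo hi].
have -> : 0 - p - (h^-1 * - (KR * I) - - (y + h) * (KR * U (y + h))) =
   - (KR * (J (y + h) - h^-1 * I)).
  by rewrite JE pR; ring.
have e0 : 0 <= J (y + h) - h^-1 * I by rewrite subr_ge0.
rewrite normrN ger0_norm ?mulr_ge0 //.
apply: (@le_trans _ _ (h * (KR * drift_slope (- a)))); last by rewrite lerDr S0.
by rewrite mulrCA ler_wpM2l // (le_trans _ dr) // lerD2l lerN2.
Qed.

(** The point a moves with the parameter; on the window from [t] to [t + 1] monotonicity gives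
    constants that depend on [t] and [c] alone. *)
Lemma stein_lip_err_le t c : KL <= c * U (- t) -> KR <= c * U (t + 1) ->
  t <= a <= t + 1 ->
  let D b := U b + (`|t| + 1) * J b in
  let K := c * U (- t) * D (t + 1) + c * U (t + 1) * D (- t) in
  stein_lip <= h * K /\ stein_err <= h * K.
Proof.
move=> KLc KRc /andP[ta at1] D K.
have na : - a <= - t by rewrite lerN2.
have t0 : 0 <= `|t| + 1 by rewrite addr_ge0.
have ba : `|a| <= `|t| + 1.
  rewrite ler_norml; apply/andP; split.
    by rewrite (le_trans _ ta) // lerNl (le_trans (ler_norm _)) // normrN lerDl.
  by rewrite (le_trans at1) // lerD2r ler_norm.
have slope b B : b <= B -> `|b| <= `|t| + 1 -> drift_slope b <= D B.
  by move=> bB bt; rewrite lerD ?U_mono // ler_pM // J_mono.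
have drift b B : b <= B -> J b <= D B.
  move=> bB; rewrite (le_trans (J_mono bB)) // ler_wpDl // ler_peMl //.
  by rewrite lerDr.
split; apply: ler_wpM2l => //; apply: lerD; apply: ler_pM => //;
  rewrite ?drift_slope_ge0 //.
- exact: drift.
- exact: drift.
- exact: slope.
- by apply: slope; rewrite ?normrN.
Qed.

End stein_equation.

Section normal_stein_solution.
Context {R : realType} (alpha : R) (j1 : nat).
Hypothesis alpha_gt0 : 0 < alpha.
Let h : R := (Num.sqrt alpha)^-1.
Let z (j : nat) : R := (j%:R - alpha) * h.

Definition normal_stein_cst t : R :=
  gauss_cst * mills (- t) * (mills (t + 1) + (`|t| + 1) * mills_drift (t + 1)) +
  gauss_cst * mills (t + 1) * (mills (- t) + (`|t| + 1) * mills_drift (- t)).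

Lemma normal_stein_solution t : t <= z j1 <= t + 1 ->
  exists (f : nat -> R) (C L : R), [/\ forall j, 0 <= f j <= C,
    forall j, `|f j.+1 - f j| <= L, L <= h * normal_stein_cst t &
    forall j, `|(j < j1)%:R - Phi (z j1) -
      h * (alpha * f j.+1 - j%:R * f j)| <= h * normal_stein_cst t].
Proof.
(* [kappa] is the normal density at the threshold. Times [mills] at the two reflected points it
   gives the upper tail [KL] and the lower tail [KR], so the gluing condition is automatic. *)
move=> ta; pose kappa : R := gauss_cst * expR (- (z j1 ^+ 2 / 2)).
have kappa_ge0 : 0 <= kappa by rewrite mulr_ge0 ?expR_ge0 ?gauss_cst_ge0.
have kc : kappa <= gauss_cst.
  rewrite ler_piMr ?gauss_cst_ge0 // -expR0 ler_expR oppr_le0 divr_ge0 //.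
  exact: sqr_ge0.
have h_gt0 : 0 < h by rewrite invr_gt0 sqrtr_gt0.
have halpha : h * alpha = h^-1.
  rewrite -[X in h * X](sqr_sqrtr (ltW alpha_gt0)) expr2 /h invrK mulKf //.
  by rewrite gt_eqF // sqrtr_gt0.
pose KL := kappa * mills (- z j1); pose KR := kappa * mills (z j1).
have KL_ge0 : 0 <= KL by rewrite mulr_ge0 ?mills_ge0.
have KR_ge0 : 0 <= KR by rewrite mulr_ge0 ?mills_ge0.
have glue : KL * mills (z j1) = KR * mills (- z j1) by rewrite /KL mulrAC.
have KLc : KL <= gauss_cst * mills (- t).
  by apply: ler_pM => //; rewrite ?mills_ge0 // mills_increasing // lerN2; case/andP: ta.
have KRc : KR <= gauss_cst * mills (t + 1).
  by apply: ler_pM => //; rewrite ?mills_ge0 // mills_increasing //; case/andP: ta.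
have pL : 1 - Phi (z j1) = KL := Phi_compl (z j1).
have pR : Phi (z j1) = KR := PhiE (z j1).
have JE x : mills_drift x = 1 + x * mills x :> R by [].
have zE j : z j = (j%:R - alpha) * h by [].
have [lip err] := stein_lip_err_le (@mills_ge0 R) (@mills_increasing R)
  (@mills_drift_ge0 R) (@mills_drift_increasing R) h_gt0 KL_ge0 KR_ge0 KLc KRc ta.
have mono := @mills_increasing R; have dmono := @mills_drift_increasing R.
have inc := @mills_increment R; have d_ge0 := @mills_drift_ge0 R.
exists (stein_f mills KL KR z j1), (KL * mills (z j1)), (stein_lip mills_drift h KL KR z j1).
split=> [||//|j].
- exact: (stein_f_bound (@mills_ge0 R) mono h_gt0 zE KL_ge0 KR_ge0 glue).
- exact: (stein_f_lip mono d_ge0 dmono inc h_gt0 zE KL_ge0 KR_ge0 glue).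
- apply: le_trans err; exact: (stein_equation (@mills_ge0 R) mono d_ge0 dmono JE
    inc h_gt0 halpha zE KL_ge0 KR_ge0 pL pR glue).
Qed.

End normal_stein_solution.

(** * Convergence in distribution *)

Lemma exp_coeffS {R : realType} (a : R) j :
  exp_coeff a j.+1 = a / j.+1%:R * exp_coeff a j.
Proof. by rewrite /exp_coeff /= exprS factS natrM [RHS]mulf_div. Qed.

Lemma cvg_sum_ord {R : realType} {T : Type} {F : set_system T} {FF : Filter F}
    n (f : nat -> T -> R) (l : nat -> R) :
  (forall j, f j x @[x --> F] --> l j) ->
  \sum_(j < n) f j x @[x --> F] --> \sum_(j < n) l j.
Proof.
move=> fl; elim: n => [|n IH].
  by under eq_fun do rewrite big_ord0; rewrite big_ord0; exact: cvg_cst.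
under eq_fun do rewrite big_ord_recr; rewrite big_ord_recr.
exact: cvgD.
Qed.

(** * Limit laws from an abstract Stein bound with relative error delta *)

Section limit_theorems.
Context {R : realType} {dO : measure_display} {Omega : R -> measurableType dO}.
Context (P : forall s, probability (Omega s) R) (H : forall s, Omega s -> nat).
Arguments H : clear implicits.
Context (alpha delta : R -> R).
Hypothesis mH : forall s : R, 0 < s -> forall A : set nat, measurable (H s @^-1` A).
Hypothesis EH : forall s : R, 0 < s ->
  ('E_(P s)[fun w => (H s w)%:R] = (alpha s)%:E)%E.
Hypothesis alpha_ge0 : forall s : R, 0 < s -> 0 <= alpha s.
Hypothesis stein : forall s : R, 0 < s -> delta s <= 1 ->
  forall (f : nat -> R) (C L : R), (forall i, 0 <= f i <= C) ->
  (forall i, `|f i.+1 - f i| <= L) ->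
  `|fine (\int[P s]_w (alpha s * f (H s w).+1 - (H s w)%:R * f (H s w))%:E)| <=
    L * (alpha s * delta s).
Hypothesis delta_ge0 : forall s : R, 0 < s -> 0 <= delta s.
Hypothesis delta0 : delta s @[s --> +oo] --> 0.

Let near_gt0 : \forall s \near +oo, 0 < (s : R).
Proof. exact: nbhs_pinfty_gt. Qed.

Let near_delta1 : \forall s \near +oo, delta s <= 1.
Proof. by apply: (cvgr_le (0 : R)) => //; exact: ltr01. Qed.

Section poisson_limit.
Variable a : R.
Hypothesis a_gt0 : 0 < a.
Hypothesis alpha_a : alpha s @[s --> +oo] --> a.

Let p s j := pmass (P s) (H s) j.
Let c j : R := exp_coeff a j.

Let cS j : c j.+1 = a / j.+1%:R * c j.
Proof. exact: exp_coeffS. Qed.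

Let p_bound s j : 0 < s -> `|p s j| <= 1.
Proof.
by move=> s0; rewrite ger0_norm ?pmass_ge0 // (pmass_le1 (P s) (mH s0)).
Qed.

Let p_rec s j : 0 < s -> delta s <= 1 ->
  `|alpha s * p s j - j.+1%:R * p s j.+1| <= alpha s * delta s.
Proof.
move=> s0 ds; rewrite -(integral_pmass_diff (P s) (mH s0)) ?alpha_ge0 //.
rewrite -[leRHS]mul1r.
apply: (stein s0 ds (f := fun i => (i == j.+1)%:R) (C := 1)) => [i|i].
  by case: (i == _); rewrite ?ler01 ?lexx.
by case: (_ == _); case: (_ == _); rewrite ?subrr ?subr0 ?sub0r ?normrN ?normr0 ?normr1.
Qed.

(** The approximate recursion fixes only the ratios a^j / j! of the masses; the mass at 0 stays as
    an unknown factor. *)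
Let p_cvg j : p s j - c j * p s 0%N @[s --> +oo] --> (0 : R).
Proof.
elim: j => [|j IH].
  under eq_fun do rewrite /c /exp_coeff /= expr0 fact0 divr1 mul1r subrr.
  exact: cvg_cst.
pose e s := `|alpha s * delta s| + `|alpha s - a| + a * `|p s j - c j * p s 0%N|.
apply: (@cvg0_le_norm _ _ _ _ _ e).
  near=> s.
  have s0 : 0 < s by near: s.
  have ds : delta s <= 1 by near: s.
  have j1 : 1 <= j.+1%:R :> R by rewrite ler1n.
  have j0 : 0 < j.+1%:R :> R by rewrite ltr0n.
  rewrite cS -(ler_pM2l j0) -{1}(ger0_norm (ltW j0)) -normrM.
  have -> : j.+1%:R * (p s j.+1 - a / j.+1%:R * c j * p s 0%N) =
     - (alpha s * p s j - j.+1%:R * p s j.+1) + (alpha s - a) * p s j +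
     a * (p s j - c j * p s 0%N).
    move: (p s j.+1) => y; move: (j.+1%:R) j0 => z z0.
    by field; rewrite gt_eqF.
  apply: le_trans (ler_normD _ _) _; apply: (@le_trans _ _ (e s)); last first.
    by rewrite ler_peMl // /e !addr_ge0 // mulr_ge0 // ltW.
  rewrite /e lerD //; last by rewrite normrM (ger0_norm (ltW a_gt0)).
  apply: le_trans (ler_normD _ _) _; rewrite lerD //.
    rewrite normrN (le_trans (p_rec _ s0 ds)) //; exact: ler_norm.
  by rewrite normrM ler_piMr // p_bound.
have : e s @[s --> +oo] --> `|a * 0| + `|a - a| + a * `|0 : R|.
  rewrite /e; apply: cvgD; last by apply: cvgM; [exact: cvg_cst|exact: cvg_norm].
  apply: cvgD; apply: cvg_norm; first exact: cvgM.
  by apply: cvgB => //; exact: cvg_cst.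
by rewrite mulr0 subrr !normr0 mulr0 !addr0.
Unshelve. all: by end_near. Qed.

(** The normalisation comes from tightness: the first J masses nearly sum to 1, and by [p_cvg] they
    nearly sum to the mass at 0 times a partial sum of exp a. *)
Let p0_cvg : p s 0%N @[s --> +oo] --> expR (- a).
Proof.
suff : expR a * p s 0%N - 1 @[s --> +oo] --> (0 : R).
  move=> h; have : expR (- a) * (expR a * p s 0%N - 1 + 1) @[s --> +oo] -->
      expR (- a) * (0 + 1).
    by apply: cvgM; [exact: cvg_cst|apply: cvgD => //; exact: cvg_cst].
  rewrite add0r mulr1; apply: cvg_trans; apply: near_eq_cvg; near=> s.
  by rewrite subrK mulrA -expRD addNr expR0 mul1r.
apply/cvgr0Pnorm_le => e e0.
have e3 : 0 < e / 3 by rewrite divr_gt0.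
pose S J := \sum_(j < J) c j.
have Scvg : S J @[J --> \oo] --> expR a.
  rewrite (_ : S = series (exp_coeff a)); first exact: is_cvg_series_exp_coeff.
  by apply/funext => J; rewrite /S /series /= big_mkord.
(* [J] cuts off both the exponential series and, by Markov's inequality with mean at most a + 1, the
   mass beyond it. *)
have [J [J0 JS Ja]] : exists J, [/\ (0 < J)%N, `|expR a - S J| <= e / 3 &
    (a + 1) / J%:R <= e / 3].
  near \oo => J; exists J; split.
  - by near: J; exact: nbhs_infty_gt.
  - by near: J; move/cvgrPdist_le : Scvg; exact.
  - have J0 : (0 < J)%N by near: J; exact: nbhs_infty_gt.
    rewrite ler_pdivrMr ?ltr0n // mulrC -ler_pdivrMr //.
    by near: J; exact: nbhs_infty_ger.
have rcvg : \sum_(j < J) (p s j - c j * p s 0%N) @[s --> +oo] --> (0 : R).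
  have : \sum_(j < J) (p s j - c j * p s 0%N) @[s --> +oo] --> \sum_(j < J) (0 : R).
    by apply: (cvg_sum_ord (f := fun j s => p s j - c j * p s 0%N) (l := fun=> 0)) => j; exact: p_cvg.
  by rewrite big1.
move/cvgr0Pnorm_le : rcvg => /(_ _ e3) rnear.
near=> s.
have s0 : 0 < s by near: s.
have r_le : `|\sum_(j < J) (p s j - c j * p s 0%N)| <= e / 3 by near: s; exact: rnear.
have al : alpha s <= a + 1.
  by near: s; apply: (cvgr_le a) => //; rewrite ltrDl.
have mk : 1 - \sum_(j < J) p s j <= e / 3.
  apply: le_trans (markov_count (mH s0) (EH s0) J0) _.
  by apply: le_trans Ja; rewrite ler_pM2r // invr_gt0 ltr0n.
have mk0 : 0 <= 1 - \sum_(j < J) p s j.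
  rewrite subr_ge0 -lee_fin -(prob_ltE (P s) (mH s0)).
  by apply: probability_le1; exact: mH.
have -> : expR a * p s 0%N - 1 = (expR a - S J) * p s 0%N -
    \sum_(j < J) (p s j - c j * p s 0%N) - (1 - \sum_(j < J) p s j).
  by rewrite sumrB -mulr_suml -/(S J); ring.
have -> : e = e / 3 + e / 3 + e / 3 by field.
apply: le_trans (ler_normB _ _) _; rewrite lerD //; last by rewrite ger0_norm.
apply: le_trans (ler_normB _ _) _; rewrite lerD //.
by rewrite normrM (le_trans _ JS) // ler_piMr // p_bound.
Unshelve. all: by end_near. Qed.

Let poisson_mass j : pmass (poisson_prob a 0) id j = c j * expR (- a).
Proof.
have pE : poisson_prob a 0 [set j] = (poisson_pmf a j)%:E.
  by rewrite /poisson_prob a_gt0 esum_set1 // lee_fin poisson_pmf_ge0.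
rewrite /pmass preimage_id; transitivity (fine (poisson_pmf a j)%:E).
  by congr fine; exact: pE.
by rewrite /= /poisson_pmf a_gt0.
Qed.

Lemma poisson_limit : cvg_in_distribution P (fun s w => (H s w)%:R) (poisson_law a).
Proof.
move=> t _.
have [t0|t0] := ltP t 0.
  have nt (i : nat) : ~ (i%:R <= t).
    by apply/negP; rewrite -ltNge (lt_le_trans t0).
  rewrite (_ : poisson_law a _ = 0%E); last first.
    change (poisson_prob a 0 (@natr R @^-1` `]-oo, t]%classic) = 0%E).
    rewrite (_ : _ @^-1` _ = set0) ?measure0 //.
    by apply/seteqP; split => // i; rewrite /= in_itv /= => /nt.
  rewrite (_ : (fun s => P s _) = fun=> 0%E); first exact: cvg_cst.
  apply/funext => s; rewrite (_ : [set _ | _] = set0) ?measure0 //.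
  by apply/seteqP; split => // w /nt.
pose n := (Num.truncn t).+1.
have tn (i : nat) : (i%:R <= t) = (i < n)%N by rewrite /n ltnS truncn_ge_nat.
have -> : poisson_law a `]-oo, t]%classic = (\sum_(j < n) c j * expR (- a))%:E.
  change (poisson_prob a 0 (@natr R @^-1` `]-oo, t]%classic) =
    (\sum_(j < n) c j * expR (- a))%:E).
  rewrite (_ : _ @^-1` _ = id @^-1` `I_n); last first.
    by apply/seteqP; split => i; rewrite /= in_itv /= tn.
  rewrite prob_ltE //; congr (_%:E); apply: eq_bigr => j _.
  exact: poisson_mass.
apply: cvg_trans (_ : (\sum_(j < n) p s j)%:E @[s --> +oo] --> _).
  apply: near_eq_cvg; near=> s.
  have s0 : 0 < s by near: s.
  rewrite -(prob_ltE (P s) (mH s0)); congr (P s _).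
  by apply/seteqP; split => w; rewrite /= tn.
apply: cvg_EFin; first by near=> s.
rewrite /comp /=; apply: (cvg_sum_ord (f := fun j s => p s j)
  (l := fun j => c j * expR (- a))) => j.
rewrite -[c j * expR (- a)]add0r.
apply: cvg_trans (_ : p s j - c j * p s 0%N + c j * p s 0%N @[s --> +oo] --> _).
  by apply: near_eq_cvg; near=> s; rewrite subrK.
by apply: cvgD; [exact: p_cvg|apply: cvgM; [exact: cvg_cst|exact: p0_cvg]].
Unshelve. all: by end_near. Qed.

End poisson_limit.

Section normal_limit.
Hypothesis alpha_y : alpha s @[s --> +oo] --> +oo.

Let h s : R := (Num.sqrt (alpha s))^-1.
(** The normalised count is at most [t] when the count is at most [edge t s]. For a nonnegative edge
    this means below [j1 t s], and [a t s] is the first lattice point above [t]. *)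
Let edge t s : R := t * Num.sqrt (alpha s) + alpha s.
Let j1 t s : nat := (Num.truncn (edge t s)).+1.
Let a t s : R := ((j1 t s)%:R - alpha s) * h s.

Let near_alpha (c : R) : \forall s \near +oo, c <= alpha s.
Proof. by move/cvgryPge : alpha_y; exact. Qed.

Let near_sqrt (c : R) : \forall s \near +oo, c <= Num.sqrt (alpha s).
Proof.
near=> s; apply: (le_trans (ler_norm c)); rewrite -sqrtr_sqr ler_sqrt.
  by near: s; exact: near_alpha.
by apply: le_trans (_ : 1 <= _) => //; near: s; exact: near_alpha.
Unshelve. all: by end_near. Qed.

Let h_cvg : h s @[s --> +oo] --> (0 : R).
Proof.
apply/cvgr0Pnorm_le => e e0; near=> s.
have es : e^-1 <= Num.sqrt (alpha s) by near: s; exact: near_sqrt.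
have s0 : 0 < Num.sqrt (alpha s) by apply: lt_le_trans es; rewrite invr_gt0.
rewrite ger0_norm; last by rewrite invr_ge0 ltW.
by rewrite -[leRHS]invrK lef_pV2 // posrE invr_gt0.
Unshelve. all: by end_near. Qed.

Let a_itv t s : 0 < alpha s -> 0 <= edge t s -> t <= a t s <= t + h s.
Proof.
move=> as0 e0; have s0 : 0 < Num.sqrt (alpha s) by rewrite sqrtr_gt0.
have /andP[lo hi] := truncn_itv e0.
rewrite /a /h ler_pdivlMr // ler_pdivrMr //; apply/andP; split.
  by rewrite lerBrDr ltW.
rewrite mulrDl mulVf ?gt_eqF // lerBlDr -addrA [1 + _]addrC addrA.
by rewrite /j1 -natr1 lerD2r.
Qed.

(** The discrete Stein equation is evaluated at H and integrated. Its pointwise error gives the term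
    in h; the Stein bound gives h L alpha delta, and L = O(h) with h^2 alpha = 1 leaves delta. *)
Let kolmogorov_bound t s : 0 < s -> 0 < alpha s -> delta s <= 1 ->
  t <= a t s <= t + 1 ->
  `|fine (P s (H s @^-1` `I_(j1 t s))) - Phi (a t s)| <=
    normal_stein_cst t * (h s + delta s).
Proof.
move=> s0 as0 ds ta; set j := j1 t s.
have sq0 : 0 < Num.sqrt (alpha s) by rewrite sqrtr_gt0.
have h0 : 0 < h s by rewrite invr_gt0.
have [f [C [L [fC fL LK fK]]]] := normal_stein_solution as0 ta.
pose Q i := alpha s * f i.+1 - i%:R * f i.
pose D i : R := (i < j)%:R - Phi (a t s) - h s * Q i.
have D_le i : `|D i| <= h s * normal_stein_cst t by exact: fK.
have lt_le i : `|(i < j)%:R : R| <= 1 by case: (i < j)%N; rewrite ?normr1 ?normr0.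
have intQ : `|\int[P s]_w Q (H s w)| <=
    h s * normal_stein_cst t * (alpha s * delta s).
  apply: le_trans (stein s0 ds fC fL) _.
  by rewrite ler_wpM2r // mulr_ge0 //; [exact: ltW|exact: delta_ge0].
(* A crude bound, serving integrability only, read off from the Stein equation itself. *)
have Q_le i : `|Q i| <= (h s)^-1 * (h s * normal_stein_cst t + (1 + `|Phi (a t s)|)).
  rewrite -ler_pdivrMl ?invr_gt0 // invrK -{1}(gtr0_norm h0) -normrM.
  rewrite (_ : h s * Q i = - D i + ((i < j)%:R - Phi (a t s))); last by rewrite /D; ring.
  apply: le_trans (ler_normD _ _) _; rewrite normrN lerD //.
  by apply: le_trans (ler_normB _ _) _; rewrite lerD2r.
have iQ := integrable_count (P s) (mH s0) Q_le.
have ilt := integrable_count (P s) (mH s0) lt_le.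
have ic : (P s).-integrable setT (EFin \o (fun=> Phi (a t s))).
  by apply: (integrable_count (P s) (mH s0) (F := fun=> Phi (a t s))) => _; exact: lexx.
have DE : \int[P s]_w D (H s w) = fine (P s (H s @^-1` `I_j)) - Phi (a t s) -
    h s * \int[P s]_w Q (H s w).
  rewrite -(Rintegral_count_lt (P s) (mH s0)) -[X in _ - X - _](Rintegral_cst_prob (P s)).
  rewrite -RintegralZl // -RintegralB // -RintegralB //.
    exact: integrableB _ ilt ic.
  exact: integrableZl iQ.
have -> : fine (P s (H s @^-1` `I_j)) - Phi (a t s) =
   \int[P s]_w D (H s w) + h s * \int[P s]_w Q (H s w) by rewrite DE; ring.
apply: le_trans (ler_normD _ _) _.
rewrite mulrDr lerD //.
  rewrite [leRHS]mulrC; exact: (norm_Rintegral_count (P s) (mH s0) D_le).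
rewrite normrM (gtr0_norm h0).
apply: (@le_trans _ _ (h s * (h s * normal_stein_cst t * (alpha s * delta s)))).
  by rewrite ler_wpM2l // ltW.
have -> : h s * (h s * normal_stein_cst t * (alpha s * delta s)) =
  (h s ^+ 2 * alpha s) * (normal_stein_cst t * delta s) by ring.
have -> : h s ^+ 2 * alpha s = 1.
  by rewrite /h exprVn sqr_sqrtr ?mulVf ?gt_eqF // ltW.
by rewrite mul1r.
Qed.

Lemma normal_limit : cvg_in_distribution P
  (fun s w => ((H s w)%:R - alpha s) / Num.sqrt (alpha s)) (normal_prob 0 1).
Proof.
move=> t nu_t.
have near_pos : \forall s \near +oo, [/\ 0 < s, 0 < alpha s, 0 <= edge t s,
    delta s <= 1 & h s <= 1].
  near=> s; have s0 : 0 < s by near: s.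
  have as0 : 0 < alpha s.
    by apply: lt_le_trans (_ : 1 <= _) => //; near: s; exact: near_alpha.
  split => //; last 2 first.
  - by near: s.
  - by near: s; apply: (cvgr_le (0 : R)) => //; exact: ltr01.
  (* The edge is sqrt alpha times t + sqrt alpha, hence nonnegative from here on. *)
  have ts : - t <= Num.sqrt (alpha s) by near: s; exact: near_sqrt.
  rewrite /edge -{2}(sqr_sqrtr (ltW as0)) expr2 -mulrDl mulr_ge0 ?sqrtr_ge0 //.
  by rewrite addrC -lerBlDr sub0r.
have a_cvg : a t s @[s --> +oo] --> t.
  apply: (@squeeze_cvgr _ _ _ _ (fun=> t) (fun s => t + h s)).
  - apply: filter_app near_pos; near=> s => -[s0 as0 e0 _ _]; exact: a_itv.
  - exact: cvg_cst.
  - have : t + h s @[s --> +oo] --> t + 0 by apply: cvgD; [exact: cvg_cst|exact: h_cvg].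
    by rewrite addr0.
have Phi_cvg : Phi (a t s) @[s --> +oo] --> Phi t.
  (* The continuity at [t] granted by the definition of convergence in distribution moves the
     threshold from the lattice back to [t]. *)
  have : normal_prob 0 1 `]-oo, (a t s)]%classic @[s --> +oo] --> normal_prob 0 1 `]-oo, t]%classic.
    exact: cvg_comp a_cvg nu_t.
  rewrite -[normal_prob 0 1 `]-oo, t]%classic]fineK ?fin_num_measure //.
  move/fine_cvgP => -[_]; rewrite Phi_def.
  by rewrite (_ : (fun s => Phi (a t s)) = fine \o (fun s => normal_prob 0 1 `]-oo, (a t s)]%classic));
    last by apply/funext => s /=; rewrite Phi_def.
have -> : (normal_prob 0 1 : probability (measurableTypeR R) R) `]-oo, t]%classic =
    (Phi t)%:E.
  by rewrite Phi_def fineK ?fin_num_measure.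
apply: cvg_trans (_ : (fine (P s (H s @^-1` `I_(j1 t s))))%:E @[s --> +oo] --> _).
  apply: near_eq_cvg; apply: filter_app near_pos; near=> s => -[s0 as0 e0 _ _].
  rewrite fineK; last by rewrite fin_num_measure //; exact: mH.
  congr (P s _); apply/seteqP; split => w /=;
    by rewrite ler_pdivrMr ?sqrtr_gt0 // lerBlDr -truncn_ge_nat.
apply: cvg_EFin; first by near=> s.
rewrite /comp /=.
have diff : fine (P s (H s @^-1` `I_(j1 t s))) - Phi (a t s) @[s --> +oo] --> (0 : R).
  apply: (@cvg0_le_norm _ _ _ _ _ (fun s => normal_stein_cst t * (h s + delta s))).
    apply: filter_app near_pos; near=> s => -[s0 as0 e0 ds hs].
    apply: kolmogorov_bound => //; have /andP[-> /le_trans] := a_itv as0 e0.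
    by apply; rewrite lerD2l.
  have : normal_stein_cst t * (h s + delta s) @[s --> +oo] --> normal_stein_cst t * (0 + 0).
    by apply: cvgM; [exact: cvg_cst|apply: cvgD; [exact: h_cvg|exact: delta0]].
  by rewrite addr0 mulr0.
apply: cvg_trans (_ : fine (P s (H s @^-1` `I_(j1 t s))) - Phi (a t s) + Phi (a t s)
    @[s --> +oo] --> _).
  by apply: near_eq_cvg; near=> s; rewrite subrK.
by rewrite -[Phi t]add0r; apply: cvgD; [exact: diff|exact: Phi_cvg].
Unshelve. all: by end_near. Qed.

End normal_limit.

End limit_theorems.

Lemma cvg0_expr {R : realType} {T : Type} {F : set_system T} {FF : Filter F}
    (f : T -> R) n : (\forall s \near F, 0 <= f s) ->
  f s ^+ n.+1 @[s --> F] --> (0 : R) -> f s @[s --> F] --> (0 : R).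
Proof.
move=> f0 /cvgr0Pnorm_le fn0; apply/cvgr0Pnorm_le => e e0.
have en0 : 0 < e ^+ n.+1 by rewrite exprn_gt0.
apply: filterS2 f0 (fn0 _ en0) => s fs0.
by rewrite !ger0_norm ?exprn_ge0 // ler_pXn2r // nnegrE ltW.
Qed.

(** * Vanishing of the maximal mean degree *)

Section mean_degree_limit.
Context {d : measure_display} {T : measurableType d} {R : realType}.
Context (mu : probability T R) (eps : R) (phi : R -> T * T -> R).
Context {dO : measure_display} {Omega : R -> measurableType dO}.
Context (P : forall s : R, probability (Omega s) R).
Context (N : forall s : R, {RV (P s) >-> nat}).
Context (X : forall s : R, nat -> {RV (P s) >-> T}).
Context (E : forall s : R, nat -> nat -> {RV (P s) >-> bool}).
Hypothesis hG : forall s : R, 0 < s ->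
  random_connection_model mu s (phi s) (N s) (X s) (E s).
Hypothesis heps : 0 < eps.
Hypothesis hphi : forall s : R, 0 < s -> Phi_ mu eps (phi s).

(** By [mean_count_lb], (eps x)^(k-1) <= k! alpha / s, and the exponent k - 1 is positive. *)
Lemma max_mean_degree_cvg0 k : (2 <= k)%N ->
  mean_count s (phi s) (X s) k / s @[s --> +oo] --> (0 : R) ->
  max_mean_degree mu s (phi s) @[s --> +oo] --> (0 : R).
Proof.
case: k => [|[|k]] // _ a0.
pose x s := max_mean_degree mu s (phi s).
have s_gt0 : \forall s \near +oo, 0 < (s : R) by exact: nbhs_pinfty_gt.
suff ex0 : eps * x s @[s --> +oo] --> (0 : R).
  have : eps^-1 * (eps * x s) @[s --> +oo] --> eps^-1 * 0.
    by apply: cvgM; [exact: cvg_cst|exact: ex0].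
  by rewrite mulr0; under eq_fun do rewrite mulKf ?gt_eqF //.
have x_ge0 s : 0 < s -> 0 <= eps * x s.
  move=> s0; apply: mulr_ge0; first exact: ltW.
  exact: (max_mean_degree_ge0 (hphi s0) s0).
apply: (@cvg0_expr _ _ _ _ _ k).
  by apply: filterS s_gt0 => s; exact: x_ge0.
apply: (@cvg0_le_norm _ _ _ _ _
  (fun s => k.+2`!%:R * (mean_count s (phi s) (X s) k.+2 / s))).
  apply: filterS s_gt0 => s s0; rewrite ger0_norm ?exprn_ge0 ?x_ge0 //.
  rewrite mulrA ler_pdivlMr // mulrC [leRHS]mulrC -ler_pdivrMr ?ltr0n ?fact_gt0 //.
  exact: (mean_count_lb (hG s0) heps (hphi s0) s0 (k := k.+2)).
rewrite -[X in _ --> X](mulr0 (k.+2`!%:R : R)).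
by apply: cvgM; [exact: cvg_cst|exact: a0].
Qed.

End mean_degree_limit.

Theorem theorem2p4 (R : realType) (d : measure_display) (T : measurableType d)
    (mu : probability T R) (eps : R) (heps : 0 < eps)
    (phi : R -> T * T -> R)
    (hphi : forall s : R, 0 < s -> Phi_ mu eps (phi s))
    (k : nat) (hk : (2 <= k)%N)
    (dO : measure_display) (Omega : R -> measurableType dO)
    (P : forall s : R, probability (Omega s) R)
    (N : forall s : R, {RV (P s) >-> nat})
    (X : forall s : R, nat -> {RV (P s) >-> T})
    (E : forall s : R, nat -> nat -> {RV (P s) >-> bool})
    (hG : forall s : R, 0 < s ->
       random_connection_model mu s (phi s) (N s) (X s) (E s)) :
  let H (s : R) (w : Omega s) : R := (rcm_H (N s) (E s) k w)%:R in
  let EH (s : R) : \bar R := ('E_(P s)[H s])%E in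
  (forall alpha : R, 0 < alpha ->
     EH s @[s --> +oo] --> alpha%:E ->
     cvg_in_distribution P H (poisson_law alpha))
  /\
  (EH s @[s --> +oo] --> +oo%E ->
   (EH s * (s^-1)%:E)%E @[s --> +oo] --> 0%E ->
   cvg_in_distribution P
     (fun s w => (H s w - fine (EH s)) / Num.sqrt (fine (EH s)))
     (normal_prob 0 1)).
Proof.
move=> H EH.
pose n s := rcm_H (N s) (E s) k; pose alpha s := fine (EH s).
pose delta s : R := stein_const k * max_mean_degree mu s (phi s).
have EHE s (s0 : 0 < s) : EH s = (mean_count s (phi s) (X s) k)%:E.
  exact: (expectation_rcm_H (hG s s0) (hphi s s0) s0 k).
have alphaE s (s0 : 0 < s) : alpha s = mean_count s (phi s) (X s) k.
  by rewrite /alpha EHE.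
have s_gt0 : \forall s \near +oo, 0 < (s : R) by exact: nbhs_pinfty_gt.
have k0 : (0 < k)%N by exact: leq_trans hk.
have mn s (s0 : 0 < s) (A : set nat) : measurable (n s @^-1` A).
  rewrite (_ : _ @^-1` _ = [set w | A (conn_subgraphs k
      (adj (random_graph (N s) (E s) w)))]); last first.
    by apply/funext => w /=; rewrite /n (rcm_HE (hG s s0)).
  exact: (measurable_graph_event (N s) (E s) (fun n g => A (conn_subgraphs k (adj g)))).
have En s (s0 : 0 < s) : ('E_(P s)[fun w => (n s w)%:R] = (alpha s)%:E)%E.
  by rewrite alphaE // -EHE.
have alpha_ge0 s (s0 : 0 < s) : 0 <= alpha s.
  by rewrite alphaE // (mean_count_ge0 _ (hphi s s0) s0).
have delta_ge0 s (s0 : 0 < s) : 0 <= delta s.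
  by rewrite mulr_ge0 // (max_mean_degree_ge0 (hphi s s0) s0).
have stein s (s0 : 0 < s) (ds : delta s <= 1) (f : nat -> R) (C L : R)
    (fC : forall i, 0 <= f i <= C) (fL : forall i, `|f i.+1 - f i| <= L) :
  `|fine (\int[P s]_w (alpha s * f (n s w).+1 - (n s w)%:R * f (n s w))%:E)| <=
    L * (alpha s * delta s).
  rewrite alphaE //; exact: (real_stein_bound (hG s s0) (hphi s s0) s0 k0 fC fL ds).
have delta0 : alpha s / s @[s --> +oo] --> (0 : R) -> delta s @[s --> +oo] --> (0 : R).
  move=> as0; rewrite -[X in _ --> X](mulr0 (stein_const k : R)).
  apply: cvgM; first exact: cvg_cst.
  apply: (max_mean_degree_cvg0 hG heps hphi hk); apply: cvg_trans as0.
  by apply: near_eq_cvg; apply: filterS s_gt0 => s s0; rewrite alphaE.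
split=> [a a0 EHa|EHy EHs].
  have alpha_a : alpha s @[s --> +oo] --> a by exact: fine_cvg EHa.
  apply: (poisson_limit mn En alpha_ge0 stein _ a0 alpha_a).
  (* Here alpha converges, so alpha / s -> 0 comes from 1 / s -> 0. *)
  apply: delta0; rewrite -[X in _ --> X](mulr0 a); apply: cvgM => //.
  by apply/(gtr0_cvgV0 (f := id) s_gt0).
apply: (normal_limit mn stein delta_ge0).
  apply: delta0; have /fine_cvg : (alpha s / s)%:E @[s --> +oo] --> (0 : R)%:E.
    apply: cvg_trans EHs; apply: near_eq_cvg; apply: filterS s_gt0 => s s0 /=.
    by rewrite EFinM -En.
  exact.
apply/cvgeryP; apply: cvg_trans EHy; apply: near_eq_cvg.
by apply: filterS s_gt0 => s s0 /=; rewrite -En.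
Qed.
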